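(* Assume in addition that the unwrapping satisfies $\bar f_t=\mathrm{id}$ on the annulus $S\times[0,3/4]\subset D$ for every $t\in J$. Then for each $t\in J$, the measure $\mu_t$, regarded as a measure on $D$ supported on $I$, is physical for $H_t$ with respect to the coordinate measure $dy\,ds$ on $D$; consequently the measure $\hat\mu_t$ on $\hat D_t$ is an inverse limit physical measure for $\hat H_t$, i.e. it has a basin $\hat B\subset\hat D_t$ with $\pi_0(\hat B)$ of positive $dy\,ds$-measure.
   Context: Let $I=[-1,1]$, $J=(1,2]$, $f_t(x)=\min(t(x-1)+3,\,t(1-x)-1)$, $\mu_t$ the unique absolutely continuous $f_t$-invariant probability on $I$. Let $S$ be the circle of radius 2 with angular coordinate $y$ and $D$ the disk of radius 2 with coordinates $(y,s)\in S\times[0,1]$ (from a smooth embedding of the mapping cylinder of $y\mapsto\cos y$), where $(y,0)=y\in S$ and $(y,1)=\cos y\in I\subset D$. Let $\Upsilon(y,s)=(y,2s)$ for $s\le1/2$, $(y,1)$ for $s\ge1/2$. An unwrapping is a continuous family of orientation-preserving near-homeomorphisms $\bar f_t\colon D\to D$ with $\bar f_t$ injective on $I$, $\bar f_t(I)\subset\{s\ge 1/2\}$, $\Upsilon\circ\bar f_t|_I=f_t$, and second coordinate of $\bar f_t(y,s)$ equal to $s$ for $s\le1/2$. $H_t=\Upsilon\circ\bar f_t$, $\hat D_t=\varprojlim(D,H_t)$ (threads $\langle z_0,z_1,\dots\rangle$ with $H_t(z_{n+1})=z_n$, projections $\pi_n$, natural extension $\hat H_t$), and $\hat\mu_t$ the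 unique $\hat H_t$-invariant measure with $(\pi_n)_*\hat\mu_t=\mu_t$. For continuous $f\colon M\to M$ with invariant probability $\nu$, a point $x$ is regular for $\nu$ if $\frac1n\sum_{i<n}\alpha(f^ix)\to\int\alpha\,d\nu$ for all continuous $\alpha$; a basin is a set of regular points; $\nu$ is physical if it has a basin of positive Lebesgue measure. *)

(* Defs.v *)
From HB Require Import structures.
From mathcomp Require Import all_boot all_order all_algebra.
From mathcomp Require Import all_classical all_reals all_analysis.

Set Implicit Arguments.
Unset Strict Implicit.
Unset Printing Implicit Defensive.

Import Order.TTheory GRing.Theory Num.Theory.
Import numFieldNormedType.Exports.
Local Open Scope classical_set_scope.
Local Open Scope ring_scope.

Section Defs.
Variable R : realType.

Definition Iset : set R := `[-1, 1].
Definition Jset : set R := `]1, 2].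

Definition ft (t x : R) : R := Num.min (t * (x - 1) + 3) (t * (1 - x) - 1).

(** Concrete realisation of the disk D of radius 2 in R^2 as the mapping
    cylinder of y |-> cos y : the point with coordinates (y,s) is phi (y,s).
    (y,0) lies on the circle S of radius 2 with angle y, and
    phi (y,1) = (cos y, 0) is the point cos y of I = [-1,1] x {0}. *)
Definition phi (c : R * R) : R * R :=
  ((2 - c.2) * cos c.1, 2 * (1 - c.2) * sin c.1).

Definition Cbox : set (R * R) :=
  [set c | 0 <= c.1 < 2 * pi /\ 0 <= c.2 <= 1].

Definition Dset : set (R * R) := phi @` Cbox.

Definition inI (x : R) : R * R := (x, 0).
Definition IinD : set (R * R) := inI @` Iset.

Definition coords (p : R * R) : R * R :=
  xget (0, 0) [set c | Cbox c /\ phi c = p].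

Definition Upsilon (p : R * R) : R * R :=
  let c := coords p in phi (c.1, Num.min (2 * c.2) 1).

Definition homeoD (h : R * R -> R * R) : Prop :=
  {within Dset, continuous h} /\
  (forall p, Dset p -> Dset (h p)) /\
  exists g : R * R -> R * R,
    [/\ {within Dset, continuous g},
        (forall p, Dset p -> Dset (g p)),
        (forall p, Dset p -> g (h p) = p) &
        (forall p, Dset p -> h (g p) = p)].

Definition circ (theta : R) : R * R := (2 * cos theta, 2 * sin theta).

(** a homeomorphism of D is orientation preserving iff the circle
    homeomorphism it induces on the boundary S lifts to an increasing map *)
Definition orient_pres (h : R * R -> R * R) : Prop :=
  exists g : R -> R, continuous g /\ {homo g : a b / a < b} /\
    forall theta, h (circ theta) = circ (g theta).

Definition op_near_homeo (f : R * R -> R * R) : Prop :=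
  (forall p, Dset p -> Dset (f p)) /\
  exists h : nat -> R * R -> R * R,
    (forall n, homeoD (h n) /\ orient_pres (h n)) /\
    forall e : R, 0 < e -> exists N : nat, forall n : nat, (N <= n)%N ->
      forall p, Dset p ->
        `|(h n p).1 - (f p).1| < e /\ `|(h n p).2 - (f p).2| < e.

Definition unwrapping (fb : R -> R * R -> R * R) : Prop :=
  {within [set q : R * (R * R) | Jset q.1 /\ Dset q.2],
     continuous (fun q : R * (R * R) => fb q.1 q.2)} /\
  forall t, Jset t ->
    [/\ op_near_homeo (fb t),
        (forall x x', Iset x -> Iset x' -> fb t (inI x) = fb t (inI x') -> x = x'),
        (forall x, Iset x -> exists c, Cbox c /\ 1 / 2 <= c.2 /\ fb t (inI x) = phi c),
        (forall x, Iset x -> Upsilon (fb t (inI x)) = inI (ft t x)) &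
        (forall c, Cbox c -> c.2 <= 1 / 2 -> exists y, fb t (phi c) = phi (y, c.2))].

Definition Ht (fb : R -> R * R -> R * R) (t : R) : R * R -> R * R :=
  Upsilon \o fb t.

Definition acip_on_I (f : R -> R) (mu : {measure set (measurableTypeR R) -> \bar R}) : Prop :=
  [/\ mu setT = 1%E, mu Iset = 1%E,
      mu `<< (@lebesgue_measure R) &
      forall A : set (measurableTypeR R), measurable A -> mu (f @^-1` A) = mu A].

Definition birkhoff {T : Type} (F : T -> T) (a : T -> R) (z : T) (n : nat) : R :=
  (\sum_(i < n) a (iter i F z)) / (n%:R : R).

Definition regular_D (H : R * R -> R * R)
    (mu : {measure set (measurableTypeR R) -> \bar R}) (z : R * R) : Prop :=
  Dset z /\
  forall a : R * R -> R, {within Dset, continuous a} ->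
    (fun n => (birkhoff H a z n)%:E) @ \oo -->
      (\int[mu]_(x in Iset) (a (inI x))%:E)%E.

Definition positive_dyds (B : set (R * R)) : Prop :=
  let E : set (measurableTypeR R * measurableTypeR R)%type :=
    Cbox `&` (phi @^-1` B) in
  measurable E /\ (0 < (@lebesgue_measure R \x @lebesgue_measure R) E)%E.

Definition Thr : topologicalType := {ptws nat -> (R * R)%type}.
Definition ThrM := g_sigma_algebraType (@open Thr).

Definition Dhat (H : R * R -> R * R) : set Thr :=
  [set z | forall n, Dset (z n) /\ H (z n.+1) = z n].

Definition Hhat (H : R * R -> R * R) (z : Thr) : Thr :=
  fun n => if n is m.+1 then z m else H (z 0%N).

Definition pi0 (z : Thr) : R * R := z 0%N.

Definition hat_measure (H : R * R -> R * R)
    (mu : {measure set (measurableTypeR R) -> \bar R})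
    (nu : {measure set ThrM -> \bar R}) : Prop :=
  [/\ nu setT = 1%E, nu (Dhat H) = 1%E,
      (forall A : set ThrM, measurable A -> nu (Hhat H @^-1` A) = nu A) &
      (forall (n : nat) (A : set (measurableTypeR R * measurableTypeR R)%type),
          measurable A -> nu [set z : ThrM | A (z n)] = mu (inI @^-1` A))].

Definition regular_hat (H : R * R -> R * R)
    (nu : {measure set ThrM -> \bar R}) (z : Thr) : Prop :=
  Dhat H z /\
  forall a : Thr -> R, {within Dhat H, continuous a} ->
    (fun n => (birkhoff (Hhat H) a z n)%:E) @ \oo -->
      (\int[nu]_(w in (Dhat H : set ThrM)) (a w)%:E)%E.

End Defs.

HB.instance Definition _ (R : realType) :=
  Measurable.copy (ThrM R) (g_sigma_algebraType (@open (Thr R))).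

(* Main.v *)
Require Import Defs.
From HB Require Import structures.
From mathcomp Require Import all_boot all_order all_algebra.
From mathcomp Require Import all_classical all_reals all_analysis.
From mathcomp Require Import measurable_realfun ring lra.
Import Order.TTheory GRing.Theory Num.Theory.
Import numFieldNormedType.Exports.
Local Open Scope classical_set_scope.
Local Open Scope ring_scope.

(** Every Lebesgue measurable set E that is invariant under the tent map ft t is
    null or conull in I: if the complement of E meets every interval in positive
    measure, self-similarity and t > 1 force it to occupy a fixed proportion of
    every interval, so E is null; and if E and its complement are each null on
    some interval, then both are null near the turning point, which is absurd.
    Hence an acip mu is ergodic, and Birkhoff's theorem gives a set G of positive
    Lebesgue measure whose orbits visit every cell of the grids of mesh 1/(m+1)
    with the right frequency.  Since fb is the identity for s <= 3/4, H maps the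
    points (y,s) with 1/2 <= s <= 3/4 to cos y, so those with cos y in G form a
    basin of mu.  The threads n |-> (y, s/2^n) above them form a basin of the
    natural extension: a continuous function on Dhat is, on threads whose n-th
    coordinate lies in I, uniformly close to a function of that coordinate once n
    is large. *)

(** * Lebesgue outer measure *)

(** Lebesgue measure enters as an outer measure: its definition by countable covers lets estimates
    on intervals pass to arbitrary sets. This handles images under Lipschitz and affine maps, and it
    also takes the place of the density theorem in the ergodicity argument.

    Regularity quantifies over all continuous functions, and an exceptional null set for each of
    them would be uncountably many. The frequencies of countably many cells fix one null set in
    advance; continuous functions are then compared with step functions. One comparison lemma serves
    both the disk and the inverse limit, as soon as an observable is controlled by a single
    coordinate in [I].

    The obstacle in the inverse limit is that neither compactness nor measurability of [Dhat] is at
    hand. Limits are therefore taken in a compact product of squares and turn out to be threads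
    inside [I], where [H] is the tent map; integrals are computed on the Borel set [Ihat] of full
    measure. *)

Section OuterLebesgue.
Context {R : realType}.
Local Notation leb := (@lebesgue_measure R).
Local Open Scope ereal_scope.

Lemma leb_le (A B : set R) : A `<=` B -> leb A <= leb B.
Proof. exact: (@le_mu_ext _ _ _ (wlength idfun)). Qed.

Lemma leb_ge0 (A : set R) : 0 <= leb A.
Proof. exact: measure_ge0. Qed.

Lemma leb_sigma_subadditive : sigma_subadditive (leb : set R -> \bar R).
Proof. by apply: (@mu_ext_sigma_subadditive _ _ _ (wlength idfun)). Qed.

Lemma leb_itvcc (a b : R) : (a <= b)%R -> leb `[a, b]%classic = (b - a)%:E.
Proof.
by rewrite le_eqVlt => /predU1P[->|ab]; rewrite lebesgue_measure_itv/= lte_fin;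
  [rewrite ltxx subrr|rewrite ab].
Qed.

(** Outer measure is an infimum over countable covers by intervals []a, b]], and [nu X] is at most
    the sum of [nu] over any such cover. *)
Lemma le_leb_of_itv (nu : set R -> \bar R) (k : R) : (0 < k)%R ->
  (forall X, 0 <= nu X) -> {homo nu : A B / A `<=` B >-> A <= B} -> sigma_subadditive nu ->
  (forall a b : R, (a <= b)%R -> nu `]a, b]%classic <= (k * (b - a))%:E) ->
  forall X, nu X <= k%:E * leb X.
Proof.
move=> k0 nu0 nuS nusub nuitv X.
rewrite -ereal_inf_pZl//.
apply: le_ereal_inf_tmp => _ /= [_ [F [mF XF] <-] <-].
apply: (le_trans (nuS _ _ XF)); apply: (le_trans (nusub F)).
rewrite -nneseriesZl; last by move=> *; exact: wlength_ge0.
apply: lee_nneseries => // i _.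
have [[a b] _ <-] /= := mF i.
have [ab|ba] := leP a b.
  by rewrite wlength_itv_bnd//= -EFinM; exact: nuitv.
rewrite set_itv_ge ?wlength0 ?mule0; last by rewrite bnd_simp -leNgt ltW.
by have := nuitv 0%R 0%R (lexx _); rewrite subrr mulr0 set_itvoc0.
Qed.

Lemma leb_diam (S : set R) (d : R) : (0 <= d)%R ->
  (forall u v, S u -> S v -> (u - v <= d)%R) -> leb S <= d%:E.
Proof.
move=> d0 Sd; have [->|/set0P[u0 Su0]] := eqVneq S set0.
  by rewrite measure0 lee_fin.
have lS : has_lbound S by exists (u0 - d)%R => v Sv; have := Sd _ _ Su0 Sv; lra.
have iS : has_inf S by split => //; exists u0.
rewrite (le_trans (@leb_le _ `[inf S, (inf S + d)%R]%classic _))//; last first.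
  by rewrite leb_itvcc ?lee_fin; lra.
move=> u Su /=; rewrite in_itv/= ge_inf//= -lerBlDr.
by apply: lb_le_inf; [exists u0|move=> v Sv; have := Sd _ _ Su Sv; lra].
Qed.

(** The part of [A] in an interval of length [l] has an image of diameter at most [k * l], so
    [le_leb_of_itv] applies to the outer measure of the image of that part. *)
Lemma leb_image_lip (g : R -> R) (A : set R) (k : R) : (0 < k)%R ->
  (forall x y, A x -> A y -> (g x - g y <= k * `|x - y|)%R) ->
  leb (g @` A) <= k%:E * leb A.
Proof.
move=> k0 gk; pose nu (X : set R) : \bar R := leb (g @` (X `&` A)).
rewrite -[X in leb (g @` X)]setIid; apply: (@le_leb_of_itv nu) => //.
- by move=> B C BC; apply: leb_le; apply: image_subset; apply: setSI.
- move=> F; rewrite /nu setI_bigcupl image_bigcup; exact: leb_sigma_subadditive.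
move=> a b ab; apply: leb_diam => [|_ _ [x [+ Ax] <-] [y [+ Ay] <-]].
  by rewrite mulr_ge0 ?subr_ge0// ltW.
rewrite /= !in_itv/= => /andP[ax xb] /andP[ay yb].
rewrite (le_trans (gk _ _ Ax Ay))// ler_pM2l// ler_norml; lra.
Qed.

Lemma leb_image_affine (s r : R) (A : set R) : (s != 0)%R ->
  leb ((fun x => s * x + r)%R @` A) = `|s|%:E * leb A.
Proof.
move=> s0; apply/eqP; rewrite eq_le; apply/andP; split.
  apply: leb_image_lip; first by rewrite normr_gt0.
  by move=> x y _ _; rewrite -normrM mulrBr; have := ler_norm (s * x - s * y); lra.
rewrite -lee_pdivlMl ?normr_gt0//.
set B := _ @` A.
have {1}-> : A = (fun x => s^-1 * (x - r))%R @` B.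
  apply/seteqP; split => [x Ax|_ [_ [x Ax] <-] <-]/=; last by rewrite addrK mulKf.
  by exists (s * x + r)%R; [exists x|rewrite addrK mulKf].
rewrite -[X in X%:E * _]normfV.
apply: leb_image_lip; first by rewrite normr_gt0 invr_eq0.
move=> x y _ _; rewrite -normrM; apply: le_trans (ler_norm _). lra.
Qed.

End OuterLebesgue.

(** * Ergodicity of the tent map *)

Section Tent.
Context {R : realType}.
Local Notation leb := (@lebesgue_measure R).
Variable t : R.
Hypothesis t1 : 1 < t.
Hypothesis t2 : t <= 2.
(** The two affine branches of [ft t] meet here, at their common value 1. *)
Definition turning : R := 1 - 2 / t.
Let c := turning.
Let f := ft t.

Let t0 : 0 < t. Proof. by have := t1; lra. Qed.
Let tn0 : t != 0. Proof. by rewrite gt_eqF. Qed.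
Let tc : t * c = t - 2. Proof. by rewrite /c /turning; field. Qed.

Lemma ft_left x : x <= c -> f x = t * x + (3 - t).
Proof.
rewrite -(ler_pM2l t0) tc => xc; rewrite /f /ft min_l; lra.
Qed.

Lemma ft_right x : c <= x -> f x = - t * x + (t - 1).
Proof.
rewrite -(ler_pM2l t0) tc => xc; rewrite /f /ft min_r; lra.
Qed.

Lemma ft_itv (x : R) : -1 <= x <= 1 -> -1 <= f x <= 1.
Proof.
move=> /andP[x1 x2]; have [xc|/ltW xc] := leP x c.
  move: (xc); rewrite ft_left// -(ler_pM2l t0) tc.
  have : t * -1 <= t * x by rewrite (ler_pM2l t0).
  have := t1; have := t2.
  by move=> *; apply/andP; split; lra.
move: (xc); rewrite ft_right// -(ler_pM2l t0) tc.
have : t * x <= t * 1 by rewrite (ler_pM2l t0).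
have := t1; have := t2.
by move=> *; apply/andP; split; lra.
Qed.

Lemma ft_affine (a b : R) : ~~ (a < c < b) -> a <= b ->
  exists s r : R, `|s| = t /\ (forall x : R, a <= x <= b -> f x = s * x + r).
Proof.
rewrite negb_and -!leNgt => /orP[] h ab.
  exists (- t), (t - 1); split; first by rewrite normrN gtr0_norm.
  by move=> x /andP[ax xb]; apply: ft_right; exact: le_trans ax.
exists t, (3 - t); split; first by rewrite gtr0_norm.
by move=> x /andP[ax xb]; apply: ft_left; exact: le_trans h.
Qed.

Lemma iter_ft_itv n (x : R) : -1 <= x <= 1 -> -1 <= iter n f x <= 1.
Proof. by move=> x1; elim: n => //= n; exact: ft_itv. Qed.

(** Both branches are inverted as affine maps of the whole line, so the list may contain spurious
    points; what counts is that it is finite and contains every point that reaches [c] in fewer than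
    [k] steps. *)
Fixpoint turning_seq (k : nat) : seq R :=
  if k is j.+1 then
    c :: [seq (y - (3 - t)) / t | y <- turning_seq j] ++
         [seq ((t - 1) - y) / t | y <- turning_seq j]
  else [::].

Lemma mem_turning_seq k j x : (j < k)%N -> iter j f x = c -> x \in turning_seq k.
Proof.
elim: k j x => // k IH [|j] x /=; first by move=> _ ->; rewrite mem_head.
rewrite ltnS => jk; rewrite -iterS iterSr => /(IH _ _ jk) fx.
rewrite in_cons mem_cat; apply/orP; right; apply/orP.
have [xc|/ltW xc] := leP x c; [left|right]; apply/mapP; exists (f x) => //.
  by rewrite ft_left//; field.
by rewrite ft_right//; field.
Qed.

Lemma seq_gap (s : seq R) : exists2 d, 0 < d &
  forall x y, x \in s -> y \in s -> x < y -> d <= y - x.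
Proof.
elim: s => [|z s [d d0 IH]]; first by exists 1.
have [e e0 he] : exists2 e : R, 0 < e & forall x, x \in s -> x != z -> e <= `|x - z|.
  elim: s {IH} => [|w s [e e0 he]]; first by exists 1.
  have [wz|wz] := eqVneq w z.
    exists e => // x; rewrite in_cons => /orP[/eqP->|]; last exact: he.
    by rewrite wz eqxx.
  exists (Num.min e `|w - z|); first by rewrite lt_min e0 normr_gt0 subr_eq0.
  move=> x; rewrite in_cons => /orP[/eqP-> _|xs xz]; first by rewrite ge_min lexx orbT.
  by rewrite ge_min he.
exists (Num.min d e); first by rewrite lt_min d0.
move=> x y; rewrite !in_cons => /orP[/eqP->|xs] /orP[/eqP->|ys] xy.
- by rewrite ltxx in xy.
- by rewrite ge_min -[y - z]gtr0_norm ?subr_gt0// he ?orbT// gt_eqF.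
- by rewrite ge_min -[z - x]gtr0_norm ?subr_gt0// distrC he ?orbT// lt_eqF.
- by rewrite ge_min IH.
Qed.

(** * Distribution of an invariant set over intervals *)

Definition ft_invariant (E : set R) := forall x, -1 <= x <= 1 -> (E (f x) <-> E x).
Definition mass (E : set R) (a b : R) := fine (leb (E `&` `[a, b]%classic)).

Lemma EFin_mass E a b : leb (E `&` `[a, b]%classic) = (mass E a b)%:E.
Proof.
rewrite /mass fineK// ge0_fin_numE ?leb_ge0//.
apply: (@le_lt_trans _ _ (leb `[a, b]%classic)); first by apply: leb_le.
by rewrite lebesgue_measure_itv; case: ifP => _; rewrite ?ltry// -EFinB ltry.
Qed.

Lemma mass_ge0 E a b : 0 <= mass E a b.
Proof. by rewrite -lee_fin -EFin_mass leb_ge0. Qed.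

Lemma mass_mono E (a b a' b' : R) : a <= a' -> b' <= b -> mass E a' b' <= mass E a b.
Proof.
move=> aa bb; rewrite -lee_fin -!EFin_mass; apply: leb_le => x [Ex].
by rewrite /= !in_itv/= => /andP[ax xb]; split => //=; lra.
Qed.

Lemma mass_split E (a d b : R) : measurable (E : set (measurableTypeR R)) -> a <= d <= b ->
  mass E a d + mass E d b <= mass E a b.
Proof.
move=> mE /andP[ad db].
rewrite -lee_fin EFinD -!EFin_mass.
(* The two closed halves share [d]; removing this null point makes them disjoint. *)
have h : (leb (E `&` `[d, b]%classic) <= leb (E `&` `]d, b]%classic))%E.
  apply: (@le_trans _ _ (leb ((E `&` `]d, b]%classic) `|` [set d]))).
    apply: leb_le => x [Ex]; rewrite /= !in_itv/= => /andP[dx xb].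
    by have [->|xd] := eqVneq x d; [right|left; split=> //=; rewrite lt_neqAle eq_sym xd dx].
  apply: (le_trans (measureU2 _ _ _)) => //; first exact: measurableI.
  rewrite -[leRHS]adde0; apply: leeD => //; change (leb [set d] <= 0)%E.
  by rewrite lebesgue_measure_set1.
rewrite (le_trans (leeD2l _ h))// -measureU//; first last.
- rewrite -subset0 => x [[_ +] [_]]; rewrite /= !in_itv/= => /andP[_ xd] /andP[dx _].
  by move: (lt_le_trans dx xd); rewrite ltxx.
- exact: measurableI.
- exact: measurableI.
apply: leb_le => x [] [Ex]; rewrite /= !in_itv/= => /andP[u v]; split => //=; lra.
Qed.

Lemma mass_setC E (a b : R) : measurable (E : set (measurableTypeR R)) -> a <= b ->
  mass E a b + mass (~` E) a b = b - a.
Proof.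
move=> mE ab; apply: EFin_inj; rewrite EFinD -!EFin_mass -leb_itvcc//.
rewrite -measureU//; last first.
- by rewrite -subset0 => x [[Ex _] []].
- by apply: measurableI => //; exact: measurableC.
- exact: measurableI.
by rewrite -setIUl setUv setTI.
Qed.

(** Away from the turning point [f] is affine with slope [t] or [- t], and invariance makes it carry
    the part of [E] in the interval onto the part in the image. The last clause is what lets a
    condition on later iterates pass to the image. *)
Lemma mass_image E (a b : R) : ft_invariant E ->
  -1 <= a -> a <= b -> b <= 1 -> ~~ (a < c < b) ->
  exists a' b' : R, [/\ -1 <= a', a' <= b', b' <= 1, b' - a' = t * (b - a) &
   mass E a' b' = t * mass E a b] /\
   forall y : R, a' < y < b' -> exists2 x : R, a < x < b & f x = y.
Proof.
move=> iE a1 ab b1 cab.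
have [s [r [st fE]]] := ft_affine _ _ cab ab.
have s0 : s != 0 by rewrite -normr_gt0 st.
have st' : s = t \/ s = - t.
  by have [s0'|s0'] := leP 0 s; [left; rewrite -st ger0_norm|right; rewrite -st ltr0_norm// opprK].
pose g (x : R) := s * x + r.
have gI x : a <= x <= b -> -1 <= g x <= 1.
  by move=> xab; rewrite /g -fE// ft_itv//; lra.
have gaI : -1 <= g a <= 1 by apply: gI; rewrite lexx.
have gbI : -1 <= g b <= 1 by apply: gI; rewrite lexx andbT.
have tba : 0 <= t * (b - a) by rewrite mulr_ge0 ?subr_ge0// ltW.
have [a' [b' [aI ab' bI sz [gE gE']]]] : exists a' b' : R,
   [/\ -1 <= a', a' <= b', b' <= 1, b' - a' = t * (b - a) &
   (forall x, a' <= g x <= b' = (a <= x <= b)) /\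
   (forall x, a' < g x < b' = (a < x < b))].
  case: st' => sE; [exists (g a), (g b)|exists (g b), (g a)].
    split; [lra|rewrite /g sE; lra|lra|rewrite /g sE; lra|split => x].
      by rewrite /g sE !lerD2r !(ler_pM2l t0).
    by rewrite /g sE !ltrD2r !(ltr_pM2l t0).
  split; [lra|rewrite /g sE; lra|lra|rewrite /g sE; lra|split => x].
    by rewrite /g sE !lerD2r !mulNr !lerN2 !(ler_pM2l t0) andbC.
  by rewrite /g sE !ltrD2r !mulNr !ltrN2 !(ltr_pM2l t0) andbC.
have gK y : g ((y - r) / s) = y by rewrite /g mulrC divfK// subrK.
exists a', b'; split; [split => //|].
  rewrite /mass; suff -> : E `&` `[a', b']%classic = g @` (E `&` `[a, b]%classic).
    by rewrite leb_image_affine// st EFin_mass.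
  apply/seteqP; split => [y [Ey]|_ [x [Ex] + <-]]; rewrite /= in_itv/=.
    rewrite -{1 2}(gK y) gE => h; exists ((y - r) / s); last exact: gK.
    split; last by rewrite /= in_itv.
    by apply/iE; [lra|rewrite fE// -/(g _) gK].
  move=> h; split; last by rewrite /= in_itv/= gE.
  by rewrite /g -fE//; apply/iE => //; lra.
move=> y; rewrite -{1 2}(gK y) gE' => h; exists ((y - r) / s) => //.
by rewrite fE; [exact: gK|lra].
Qed.

(** Phrased by orbits avoiding [c] in the open interval, which makes [iter k f] affine on it and is
    inherited by the image with [k] lowered by one. *)
Definition monotone_on k (a b : R) :=
  forall x, a < x < b -> forall j, (j < k)%N -> iter j f x != c.

Lemma mass_iter E k (a b : R) : ft_invariant E -> -1 <= a -> a <= b -> b <= 1 ->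
  monotone_on k a b ->
  exists a' b' : R, [/\ -1 <= a', a' <= b', b' <= 1, b' - a' = t ^+ k * (b - a) &
   mass E a' b' = t ^+ k * mass E a b].
Proof.
move=> iE; elim: k a b => [|k IH] a b a1 ab b1 mon.
  by exists a, b; rewrite expr0 !mul1r.
have cab : ~~ (a < c < b) by apply/negP => /mon /(_ 0%N erefl); rewrite eqxx.
have [a' [b' [[a1' ab' b1' sz sm] onto]]] := @mass_image E a b iE a1 ab b1 cab.
have [|a'' [b'' [? ? ? sz' sm']]] := IH a' b' a1' ab' b1'.
  move=> y /onto[x xab <-] j jk; rewrite -iterSr; exact: mon.
by exists a'', b''; split => //; rewrite exprSr -mulrA -?sz -?sm.
Qed.

(** The minimum over finitely many grid cells is positive. The factor 2 is the length of [I], so the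
    bound implies the proportion [k] on every interval of length at least [d]. *)
Lemma mass_grid E (d : R) : (forall a b : R, -1 <= a -> a < b -> b <= 1 -> 0 < mass E a b) ->
  0 < d -> exists2 k : R, 0 < k <= 1 &
  forall a b : R, -1 <= a -> a + d <= b -> b <= 1 -> k * 2 <= mass E a b.
Proof.
move=> pos d0.
(* Grid cells have length [2 / N], and an interval of twice that length contains a whole cell. *)
have [N [N0 Nd]] : exists N : nat, (0 < N)%N /\ 4 / N%:R <= d.
  exists (Num.bound (4 / d)).+1; split => //.
  rewrite ler_pdivrMr ?ltr0n// -ler_pdivrMl// mulrC.
  by rewrite ltW// (lt_le_trans (archi_boundP _)) ?ler_nat// divr_ge0// ltW.
have N0' : 0 < N%:R :> R by rewrite ltr0n.
pose g (i : nat) : R := -1 + 2 * i%:R / N%:R.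
have gS i : g i.+1 = g i + 2 / N%:R by rewrite /g -natr1; lra.
have [k k0 kP] : exists2 k : R, 0 < k & forall i, (i < N)%N -> k <= mass E (g i) (g i.+1).
  have : (N <= N)%N by [].
  elim: {-2}N => [|M IH] MN; first by exists 1.
  have [k k0 kP] := IH (ltnW MN).
  have gM : 0 < mass E (g M) (g M.+1).
    apply: pos; rewrite ?gS ?ltrDl ?divr_gt0//.
      by rewrite /g lerDl divr_ge0.
    rewrite -gS /g -lerBrDl ler_pdivrMr//.
    have : M.+1%:R <= N%:R :> R by rewrite ler_nat.
    by lra.
  exists (Num.min k (mass E (g M) (g M.+1))); first by rewrite lt_min k0.
  move=> i; rewrite ltnS leq_eqVlt ge_min => /predU1P[->|/kP ->//].
  by rewrite lexx orbT.
exists (Num.min (k / 2) 1).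
  by rewrite lt_min divr_gt0// ge_min lexx orbT ltr01.
move=> a b a1 ab b1.
apply: (@le_trans _ _ k); first by rewrite -ler_pdivlMr// ge_min lexx.
have x0 : 0 <= (a + 1) * N%:R / 2 by rewrite divr_ge0// mulr_ge0//; lra.
have /andP[il ir] := truncn_itv x0; set i := Num.truncn _ in il ir.
have ga : a <= g i.+1.
  have : (a + 1) / 2 <= i.+1%:R / N%:R by rewrite ler_pdivlMr//; lra.
  by rewrite /g; lra.
have gb : g i.+2 <= b.
  have : i%:R / N%:R <= (a + 1) / 2 by rewrite ler_pdivrMr//; lra.
  by rewrite !gS /g; lra.
apply: (le_trans (kP i.+1 _)); last exact: mass_mono.
rewrite -(ltr_nat R).
have : i.+2%:R / N%:R <= 1 :> R.
  by move: (le_trans gb b1); rewrite /g -mulrA; move: (_ / _) => z; lra.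
rewrite ler_pdivrMr// mul1r; apply: lt_le_trans; rewrite ltr_nat//.
Qed.

Lemma expr_unbounded (M : R) : exists m, M <= t ^+ m.
Proof.
have t1' : 0 < t - 1 by rewrite subr_gt0.
have bern n : 1 + n%:R * (t - 1) <= t ^+ n.
  elim: n => [|n IH]; first by rewrite expr0 mul0r addr0.
  rewrite exprS -natr1; apply: le_trans (_ : t * (1 + n%:R * (t - 1)) <= _).
    rewrite -subr_ge0 (_ : _ - _ = n%:R * (t - 1) ^+ 2); last by ring.
    by rewrite mulr_ge0// sqr_ge0.
  by rewrite ler_pM2l.
exists (Num.bound (`|M| / (t - 1))); apply: le_trans (bern _).
apply: (le_trans (ler_norm _)).
rewrite -lerBlDl -ler_pdivrMr// ltW// (le_lt_trans _ (archi_boundP _))//.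
  by rewrite ler_pM2r ?invr_gt0//; lra.
by rewrite divr_ge0// ltW.
Qed.

(* The defect psi(J) = k|J| - mass E J is additive, is scaled by t^m when f^m is
   monotone on J, and is nonpositive on intervals of length >= d. A shorter
   interval splits into at most two pieces on which f^m is monotone, so with
   t^m >= 4 the supremum M of psi satisfies M <= max(M, 0) / 2, i.e. M <= 0. *)
Lemma mass_proportion E :  measurable (E : set (measurableTypeR R)) -> ft_invariant E ->
  (forall a b : R, -1 <= a -> a < b -> b <= 1 -> 0 < mass E a b) ->
  exists2 k : R, 0 < k <= 1 &
  forall a b : R, -1 <= a -> a <= b -> b <= 1 -> k * (b - a) <= mass E a b.
Proof.
move=> mE iE pos.
have [m tm] : exists m, 4 <= t ^+ m.
  exact: expr_unbounded.
have [d d0 dP] := seq_gap (turning_seq m).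
have [k /andP[k0 k1] kP] := @mass_grid E d pos d0.
exists k; first by rewrite k0.
pose psi a b := k * (b - a) - mass E a b.
pose S := [set psi ab.1 ab.2 | ab in
  [set ab : R * R | [/\ -1 <= ab.1, ab.1 <= ab.2 & ab.2 <= 1]]].
have Sk r : S r -> r <= k * 2.
  move=> [[a b] /= [a1 ab b1] <-]; rewrite /psi.
  have : k * (b - a) <= k * 2 by rewrite ler_pM2l//; lra.
  by have := mass_ge0 E a b; lra.
have S0 : S !=set0 by exists (psi 0 0); exists (0, 0) => //=; split; lra.
have hS : has_sup S by split=> //; exists (k * 2).
set M := sup S.
have psiM a b : -1 <= a -> a <= b -> b <= 1 -> psi a b <= M.
  by move=> *; apply: sup_ubound => //; [case: hS|exists (a, b)].
have psi_mon a b : -1 <= a -> a <= b -> b <= 1 -> monotone_on m a b ->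
    4 * psi a b <= Num.max M 0.
  move=> a1 ab b1 mon.
  have [a' [b' [? ? ? sz sm]]] := @mass_iter E m a b iE a1 ab b1 mon.
  have : t ^+ m * psi a b <= M.
    by rewrite /psi mulrBr mulrCA -sz -sm; exact: psiM.
  rewrite le_max; have [p0|p0] := leP (psi a b) 0.
    by rewrite (_ : 4 * _ <= 0) ?orbT//; lra.
  by move=> h; apply/orP; left; apply: le_trans h; rewrite ler_pM2r.
have M0 : M <= Num.max M 0 / 2.
  apply: sup_le_ub => // _ [[a b] /= [a1 ab b1] <-].
  have [dab|dab] := leP (a + d) b.
    have := kP a b a1 dab b1.
    have : k * (b - a) <= k * 2 by rewrite ler_pM2l//; lra.
    have : 0 <= Num.max M 0 by rewrite le_max lexx orbT.
    by rewrite /psi; lra.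
  have [x [/andP[ax xb] m1 m2]] :
      exists x, [/\ a <= x <= b, monotone_on m a x & monotone_on m x b].
    have [[x [xab [j jm jx]]]|nx] := pselect
        (exists x, a < x < b /\ exists2 j, (j < m)%N & iter j f x = c).
      have sx := mem_turning_seq _ _ _ jm jx.
      exists x; split; first lra.
        move=> y yab i im; apply/negP => /eqP iy.
        have sy := mem_turning_seq _ _ _ im iy.
        have := dP y x sy sx; lra.
      move=> y yab i im; apply/negP => /eqP iy.
      have sy := mem_turning_seq _ _ _ im iy.
      have := dP x y sx sy; lra.
    exists b; split; [lra| |by move=> y; lra].
    by move=> y yab i im; apply/negP => /eqP iy; apply: nx; exists y; split => //; exists i.
  have h1 := psi_mon a x a1 ax (le_trans xb b1) m1.
  have h2 := psi_mon x b (le_trans a1 ax) xb b1 m2.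
  have := @mass_split E a x b mE; rewrite ax xb => /(_ isT).
  by move: h1 h2; rewrite /psi; lra.
move=> a b a1 ab b1; have := psiM a b a1 ab b1; rewrite /psi.
by move: M0; case: (leP M 0); lra.
Qed.

(** The set function [nu], the outer measure of the part of a set in [I \ E], is at most [1 - k / 2]
    times length on intervals, hence on all sets; evaluated at [I \ E] itself, this factor below 1
    leaves only the value 0. Halving [k] keeps the factor positive when [k = 1]. *)
Lemma null_of_proportion E : measurable (E : set (measurableTypeR R)) -> ft_invariant E ->
  (forall a b : R, -1 <= a -> a < b -> b <= 1 -> 0 < mass E a b) ->
  leb (`[-1, 1]%classic `\` E) = 0%E.
Proof.
move=> mE iE pos; have [k /andP[k0 k1] kP] := @mass_proportion E mE iE pos.
set I := `[-1, 1]%classic.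
pose nu (X : set R) : \bar R := leb (X `&` (I `\` E)).
have nuk : forall X, (nu X <= (1 - k / 2)%:E * leb X)%E.
  apply: le_leb_of_itv.
  - by lra.
  - by move=> X; rewrite leb_ge0.
  - by move=> A B AB; apply: leb_le; apply: setSI.
  - by move=> F; rewrite /nu setI_bigcupl; exact: leb_sigma_subadditive.
  move=> a b ab; pose a' := Num.max a (-1); pose b' := Num.min b 1.
  have [ab'|ab'] := leP a' b'; last first.
    rewrite /nu (_ : _ `&` _ = set0).
      by rewrite measure0 lee_fin mulr_ge0 ?subr_ge0//; lra.
    rewrite -subset0 => x [] + [+ _]; rewrite /I /= !in_itv/=.
    move: ab'; rewrite /a' /b'.
    by case: (leP a (-1)); case: (leP b 1) => *; lra.
  have aa : a <= a' by rewrite /a' le_max lexx.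
  have bb : b' <= b by rewrite /b' ge_min lexx.
  have a'1 : -1 <= a' by rewrite /a' le_max lexx orbT.
  have b'1 : b' <= 1 by rewrite /b' ge_min lexx orbT.
  apply: (@le_trans _ _ (leb (~` E `&` `[a', b']%classic))).
    apply: leb_le => x []; rewrite /I /= !in_itv/= => xab [xI Ex]; split => //=.
    by rewrite /a' /b' ge_max le_min; lra.
  rewrite EFin_mass lee_fin.
  have := mass_setC E a' b' mE ab'; have := kP a' b' a'1 ab' b'1.
  have : k * (b' - a') <= b - a - (b' - a') + k * (b' - a') by lra.
  have : 0 <= k * (b - a) by rewrite mulr_ge0 ?subr_ge0// ltW.
  have : k * (b - a - (b' - a')) <= 1 * (b - a - (b' - a')).
    by rewrite ler_wpM2r//; lra.
  by lra.
have := nuk (I `\` E); rewrite /nu setIid.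
have : (leb (I `\` E) <= 2%:E)%E.
  apply: (@le_trans _ _ (leb I)); first by apply: leb_le => x [].
  by rewrite /I leb_itvcc// lee_fin; lra.
have := leb_ge0 (I `\` E).
case: (leb _) => [r| |]//=; rewrite !lee_fin => r0 _.
move=> h; congr (_%:E).
have : k * r <= 0 by lra.
by rewrite pmulr_rle0// => r0'; apply/eqP; rewrite eq_le r0 r0'.
Qed.

(* An interval on which E is null expands under ft until it contains the
   turning point, and all its images remain E-null. *)
Lemma null_turning E (a b : R) : ft_invariant E -> -1 <= a -> a < b -> b <= 1 ->
  mass E a b = 0 ->
  exists a' b' : R, a' < c < b' /\ mass E a' b' = 0.
Proof.
move=> iE a1 ab b1 m0.
have [n] := expr_unbounded (4 / (b - a)).
rewrite ler_pdivrMr ?subr_gt0// => nP.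
elim: n a b a1 ab b1 m0 nP => [|n IH] a b a1 ab b1 m0.
  by rewrite expr0; lra.
have [cab _|cab] := boolP (a < c < b); first by exists a, b.
have [a' [b' [[? ? ? sz sm] _]]] := @mass_image E a b iE a1 (ltW ab) b1 cab.
rewrite exprSr -mulrA -sz => nP; apply: (IH a' b') => //.
  by rewrite -subr_gt0 sz mulr_gt0 ?subr_gt0.
by rewrite sm m0 mulr0.
Qed.

Lemma tent_ergodic E : measurable (E : set (measurableTypeR R)) -> ft_invariant E ->
  leb (`[-1, 1]%classic `&` E) = 0%E \/ leb (`[-1, 1]%classic `\` E) = 0%E.
Proof.
move=> mE iE.
have iE' : ft_invariant (~` E) by move=> x /iE h; split; apply: contra_not => /h.
have mE' : measurable (~` E : set (measurableTypeR R)) by exact: measurableC.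
have [pos|npos] := pselect (forall a b : R, -1 <= a -> a < b -> b <= 1 -> 0 < mass E a b).
  by right; exact: null_of_proportion.
have [pos'|npos'] :=
    pselect (forall a b : R, -1 <= a -> a < b -> b <= 1 -> 0 < mass (~` E) a b).
  by left; rewrite -[X in _ `&` X]setCK -setDE; exact: null_of_proportion.
have null F : ft_invariant F ->
    ~ (forall a b : R, -1 <= a -> a < b -> b <= 1 -> 0 < mass F a b) ->
    exists a' b' : R, a' < c < b' /\ mass F a' b' = 0.
  move=> iF nF; apply: contrapT => h; apply: nF => a b a1 ab b1.
  rewrite lt_neqAle mass_ge0 andbT eq_sym; apply/negP => /eqP m0.
  by apply: h; exact: null_turning a1 ab b1 m0.
have [a [b [cab m0]]] := null _ iE npos.
have [a' [b' [cab' m0']]] := null _ iE' npos'.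
have acb : Num.max a a' < Num.min b b'.
  by apply: (@lt_trans _ _ c); rewrite ?gt_max ?lt_min; lra.
have := mass_setC E _ _ mE (ltW acb).
have := @mass_mono E a b (Num.max a a') (Num.min b b').
have := @mass_mono (~` E) a' b' (Num.max a a') (Num.min b b').
rewrite m0 m0' !le_max !ge_min !lexx !orbT => /(_ isT isT) ? /(_ isT isT) ?.
by move: acb; rewrite -subr_gt0 => *; exfalso; lra.
Qed.

End Tent.

(** * Birkhoff averages *)

Definition cesaro {R : realType} (u : nat -> R) (n : nat) : R :=
  (\sum_(i < n) u i) / n%:R.

Section Cesaro.
Context {R : realType}.
Implicit Types (u v : nat -> R) (l : R).

Lemma cesaro_cvgP u l : (forall e : R, 0 < e -> exists n0, forall n, (n0 <= n)%N ->
    `|\sum_(i < n) u i - n%:R * l| <= e * n%:R) <-> cesaro u @ \oo --> l.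
Proof.
split => [h|/cvgrPdist_le h].
  apply/cvgrPdist_le => e e0; have [n0 n0P] := h e e0.
  exists n0.+1 => // n /= n0n.
  have n0' : 0 < n%:R :> R by rewrite ltr0n; apply: leq_trans n0n.
  rewrite /cesaro distrC -(ler_pM2r n0') -[X in `|_| * X]gtr0_norm// -normrM.
  rewrite mulrBl divfK ?gt_eqF// [l * _]mulrC; apply: n0P; exact: ltnW.
move=> e e0; have [n0 _ n0P] := h e e0; exists n0.+1 => n n0n.
have n0' : 0 < n%:R :> R by rewrite ltr0n; apply: leq_trans n0n.
have := n0P n (ltnW n0n).
rewrite /cesaro distrC -(ler_pM2r n0') -[X in `|_| * X]gtr0_norm// -normrM.
by rewrite mulrBl divfK ?gt_eqF// [l * _]mulrC.
Qed.

Lemma cesaro_shift1 u l : cesaro (fun i => u i.+1) @ \oo --> l -> cesaro u @ \oo --> l.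
Proof.
move=> /cesaro_cvgP h; apply/cesaro_cvgP => e e0.
have e20 : 0 < e / 2 by rewrite divr_gt0.
have [n0 n0P] := h _ e20.
pose C : R := `|u 0%N - l|.
exists (maxn n0 (Num.bound (C / (e / 2)))).+1 => -[//|n].
rewrite ltnS geq_max => /andP[n0n bn].
have Cn : C <= e / 2 * n%:R.
  rewrite mulrC -ler_pdivrMr// ltW//.
  by rewrite (lt_le_trans (archi_boundP _)) ?ler_nat// divr_ge0 ?normr_ge0// ltW.
rewrite big_ord_recl /= (eq_bigr (fun i : 'I_n => u i.+1)); last by [].
have -> : u 0%N + \sum_(i < n) u i.+1 - n.+1%:R * l =
   (u 0%N - l) + (\sum_(i < n) u i.+1 - n%:R * l) by rewrite -natr1; ring.
apply: (le_trans (ler_normD _ _)); have := n0P n n0n.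
rewrite -[n.+1%:R]natr1 -/C.
lra.
Qed.

Lemma cesaro_shift N u l :
  cesaro (fun i => u (i + N)%N) @ \oo --> l -> cesaro u @ \oo --> l.
Proof.
elim: N u => [|N IH] u.
  by under [X in cesaro X]eq_fun do rewrite addn0.
move=> h; apply: cesaro_shift1; apply: IH.
by under [X in cesaro X]eq_fun do rewrite -addnS.
Qed.

Lemma cesaro_approx u l :
  (forall e : R, 0 < e -> exists N (v : nat -> R) (m : R), [/\ cesaro v @ \oo --> m,
     forall i, `|u (i + N)%N - v i| <= e & `|l - m| <= e]) ->
  cesaro u @ \oo --> l.
Proof.
move=> h; apply/cesaro_cvgP => e e0.
have e30 : 0 < e / 5 by rewrite divr_gt0.
have [N [v [m [vm uv lm]]]] := h _ e30.
pose w i := if (i < N)%N then u i else v (i - N)%N.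
have wm : cesaro w @ \oo --> m.
  apply: (cesaro_shift N).
  under [X in cesaro X]eq_fun => i do rewrite /w ltnNge leq_addl /= addnK.
  exact: vm.
have uw i : `|u i - w i| <= e / 5.
  rewrite /w; case: ltnP => [_|Ni]; first by rewrite subrr normr0 ltW.
  by rewrite -{1}(subnK Ni).
have [n0 n0P] := (cesaro_cvgP w m).2 wm _ e30.
exists n0 => n n0n.
have h1 : `|\sum_(i < n) u i - \sum_(i < n) w i| <= e / 5 * n%:R.
  rewrite -sumrB (le_trans (ler_norm_sum _ _ _))//.
  apply: (@le_trans _ _ (\sum_(i < n) (e / 5))); first by apply: ler_sum => i _; exact: uw.
  by rewrite sumr_const card_ord mulr_natr.
have h2 := n0P n n0n.
have h3 : `|n%:R * l - n%:R * m| <= e / 5 * n%:R.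
  by rewrite -mulrBr normrM ger0_norm// mulrC ler_wpM2r.
have n_ge0 : 0 <= e * n%:R by rewrite mulr_ge0// ltW.
move: h1 h2 h3; rewrite !ler_norml; lra.
Qed.

(** A bounded partial sum disappears after division by [n], leaving an error of at most the margin
    [1 / (k + 1)]. Margins are indexed by integers so that the exceptional sets of the ergodic
    theorem stay countable in number. *)
Lemma cesaro_of_sum_le u l :
  (forall k : nat, exists M : R, forall n, \sum_(i < n) (u i - l - k.+1%:R^-1) <= M) ->
  (forall k : nat, exists M : R, forall n, \sum_(i < n) (l - u i - k.+1%:R^-1) <= M) ->
  cesaro u @ \oo --> l.
Proof.
move=> hU hL; apply/cesaro_cvgP => e e0.
have e20 : 0 < e / 2 by rewrite divr_gt0.
pose k := Num.bound (2 / e).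
have ke : k.+1%:R^-1 <= e / 2.
  rewrite -[leRHS]invf_div lef_pV2 ?posrE ?divr_gt0// ltW//.
  by rewrite (lt_le_trans (archi_boundP _)) ?ler_nat// divr_ge0// ltW.
have [M1 M1P] := hU k; have [M2 M2P] := hL k.
exists (Num.bound ((`|M1| + `|M2|) / (e / 2))) => n nb.
have Cn : `|M1| + `|M2| <= e / 2 * n%:R.
  rewrite mulrC -ler_pdivrMr// ltW//.
  by rewrite (lt_le_trans (archi_boundP _)) ?ler_nat// divr_ge0 ?addr_ge0// ltW.
have := M1P n; have := M2P n.
rewrite !sumrB !sumr_const card_ord -![l *+ n]mulr_natr -!(mulr_natr (_^-1)).
move: (\sum_(i < n) u i) (k.+1%:R^-1) ke => s r ke h1 h2.
have ken : r * n%:R <= e / 2 * n%:R by rewrite ler_wpM2r.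
have := ler_norm M1; have := ler_norm M2.
have := normr_ge0 M1; have := normr_ge0 M2.
rewrite ler_norml [n%:R * l]mulrC; lra.
Qed.

End Cesaro.

Lemma null_bigcup {d} {T : measurableType d} {R : realType}
    (mu : {measure set T -> \bar R}) (F : nat -> set T) :
  (forall n, measurable (F n)) -> (forall n, mu (F n) = 0%E) ->
  mu (\bigcup_n F n) = 0%E.
Proof.
move=> mF F0; apply/eqP; rewrite eq_le measure_ge0 andbT.
apply: (le_trans (measure_sigma_subadditive _ mF _ (@subset_refl _ _))).
  exact: bigcup_measurable.
by rewrite eseries0.
Qed.

Lemma measurable_lt_cst {d} {T : measurableType d} {R : realType} (h : T -> R) (a : R) :
  measurable_fun setT h -> measurable [set x | h x < a].
Proof.
move=> mh; rewrite (_ : mkset _ = setT `&` h @^-1` `]-oo, a[%classic); first exact: mh.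
by apply/seteqP; split => x; rewrite /= in_itv/= ?andTb //; case.
Qed.

Lemma measurable_gt_cst {d} {T : measurableType d} {R : realType} (h : T -> R) (a : R) :
  measurable_fun setT h -> measurable [set x | a < h x].
Proof.
move=> mh; rewrite (_ : mkset _ = setT `&` h @^-1` `]a, +oo[%classic); first exact: mh.
by apply/seteqP; split => x; rewrite /= in_itv/= andbT //; case.
Qed.

(** * The maximal ergodic lemma and pointwise convergence for ergodic maps *)

Section Birkhoff.
Context {d} {T : measurableType d} {R : realType}.
Variable mu : {measure set T -> \bar R}.
Hypothesis mu1 : mu setT = 1%E.
Variable f : T -> T.
Hypothesis mf : measurable_fun setT f.
Hypothesis muf : forall A, measurable A -> mu (f @^-1` A) = mu A.
Hypothesis ergf : forall A, measurable A -> f @^-1` A = A ->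
  mu A = 0%E \/ mu (~` A) = 0%E.

Lemma prob_integrable (g : T -> R) (K : R) : measurable_fun setT g ->
  (forall x, `|g x| <= K) -> mu.-integrable setT (EFin \o g).
Proof.
move=> mg gK; apply: measurable_bounded_integrable => //.
  by rewrite mu1 ltry.
by exists K; split; [exact: num_real|move=> M KM x _ /=; rewrite (le_trans (gK x))// ltW].
Qed.

Lemma Rintegral_comp_inv (h : T -> R) : measurable_fun setT h -> (forall x, 0 <= h x) ->
  (\int[mu]_x h (f x) = \int[mu]_x h x)%R.
Proof.
move=> mh h0; rewrite /Rintegral; congr fine.
rewrite -[LHS](@ge0_integral_pushforward _ _ _ _ R f mf mu setT (EFin \o h))//.
- by apply: eq_measure_integral => A mA _; exact: muf.
- by apply/measurable_EFinP.
by move=> x _; rewrite lee_fin.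
Qed.

Variable g : T -> R.
Variable K : R.
Hypothesis K0 : 0 < K.
Hypothesis mg : measurable_fun setT g.
Hypothesis gK : forall x, `|g x| <= K.
Hypothesis g_lt0 : (\int[mu]_x g x < 0)%R.

Let S n x := \sum_(i < n) g (iter i f x).
Let SS n x : S n.+1 x = g x + S n (f x).
Proof.
rewrite /S big_ord_recl /=; congr (_ + _).
by apply: eq_bigr => i _; rewrite /bump /= -iterSr.
Qed.

(* max_(1 <= k <= n+1) S_k, through the recursion behind the maximal ergodic lemma. *)
Fixpoint maxsum n x : R :=
  if n is m.+1 then g x + Num.max 0 (maxsum m (f x)) else g x.
Local Notation F := maxsum.

Lemma birkhoff_sum_le n x : S n.+1 x <= F n x.
Proof.
elim: n x => [|n IH] x; first by rewrite SS /S big_ord0 addr0.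
by rewrite SS lerD2l le_max IH orbT.
Qed.

Lemma maxsum_le n x : F n x <= F n.+1 x.
Proof.
elim: n x => [|n IH] x; first by rewrite lerDl le_max lexx.
by rewrite lerD2l ge_max !le_max lexx IH orbT.
Qed.

Lemma maxsum_ge n x : g x <= F n x.
Proof. by elim: n x => // n IH x; apply: le_trans (maxsum_le _ _). Qed.

Lemma maxsum_measurable n : measurable_fun setT (F n).
Proof.
elim: n => //= n IH; apply: measurable_funD => //.
apply: measurable_maxr => //; exact: measurableT_comp.
Qed.

Lemma maxsum_bound n x : `|F n x| <= n.+1%:R * K.
Proof.
have := K0 => K0'.
elim: n x => [|n IH] x; first by rewrite mul1r.
rewrite -natr1 mulrDl mul1r addrC (le_trans (ler_normD _ _))// lerD//.
rewrite ger0_norm ?le_max ?lexx// ge_max mulr_ge0 ?(ltW K0)//=.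
by apply: le_trans (IH (f x)); exact: ler_norm.
Qed.

(** Integrating [F n <= F n.+1] and using invariance bounds the left side by the integral of
    [max 0 (F n) - F n]. This function vanishes where [F n >= 0], and elsewhere it is at most
    [- g <= K]. *)
Lemma maxsum_neg n : - (\int[mu]_x g x)%R <= K * fine (mu [set x | F n x < 0]).
Proof.
have mFn := maxsum_measurable n.
have mneg : measurable [set x | F n x < 0].
  exact: measurable_lt_cst.
have iF m : mu.-integrable setT (EFin \o F m).
  by apply: prob_integrable (maxsum_bound m); exact: maxsum_measurable.
have ig : mu.-integrable setT (EFin \o g) by exact: prob_integrable gK.
have mmax : measurable_fun setT (fun x => Num.max 0 (F n x)).
  exact: measurable_maxr.
have bmax x : `|Num.max 0 (F n x)| <= n.+1%:R * K.
  have := maxsum_bound n x; rewrite ler_norml => h.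
  by rewrite ger0_norm ?le_max ?lexx// ge_max; lra.
have im : mu.-integrable setT (EFin \o (fun x => Num.max 0 (F n x))).
  exact: prob_integrable bmax.
have im' : mu.-integrable setT (EFin \o (fun x => Num.max 0 (F n (f x)))).
  apply: (@prob_integrable _ (n.+1%:R * K)) => //.
  exact: (measurableT_comp mmax).
have h1 : (\int[mu]_x F n x <= \int[mu]_x g x + \int[mu]_x Num.max 0 (F n x))%R.
  rewrite -(Rintegral_comp_inv _ mmax); last by move=> x; rewrite le_max lexx.
  rewrite -RintegralD//; apply: le_Rintegral => //; first exact: (iF n.+1).
  by move=> x _; exact: maxsum_le.
have iI : mu.-integrable setT (EFin \o (\1_[set x | F n x < 0] : T -> R)).
  apply: (@prob_integrable _ 1); first exact: measurable_indic.
  by move=> x; rewrite indicE; case: (_ \in _); rewrite ?normr1 ?normr0.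
have h2 : (\int[mu]_x (Num.max 0 (F n x) - F n x) <=
    \int[mu]_x (K * \1_[set x | F n x < 0] x))%R.
  apply: le_Rintegral => //.
  - by have := integrableB measurableT im (iF n).
  - exact: (integrableZl measurableT K iI).
  move=> x _; rewrite indicE; have [] := boolP (x \in _).
    rewrite inE /= => Fx; rewrite max_l; last exact: ltW.
    rewrite sub0r mulr1.
    by have := maxsum_ge n x; have := gK x; rewrite ler_norml; lra.
  by rewrite notin_setE /= => /negP; rewrite -leNgt => Fx; rewrite max_r// subrr mulr0.
move: h2; rewrite RintegralB// RintegralZl//.
rewrite {3}/Rintegral integral_indic// setIT.
lra.
Qed.

(** The set [E] of points whose sums are unbounded above is invariant, hence null or conull. If it
    were conull, the decreasing sets where [F n < 0], whose intersection avoids [E], would have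
    measures tending to 0, against the lower bound that [maxsum_neg] gives for all [n]. *)
Lemma birkhoff_sum_bounded : exists N, [/\ measurable N, mu N = 0%E &
  forall x, ~ N x -> exists M : R, forall n, \sum_(i < n) g (iter i f x) <= M].
Proof.
pose E := \bigcap_(M : nat) \bigcup_n [set x | M%:R < S n x].
have mS n : measurable_fun setT (S n).
  elim: n => [|n IH].
    by rewrite (_ : S 0 = cst 0)//; apply/funext => x; rewrite /S big_ord0.
  rewrite (_ : S n.+1 = (fun x => g x + S n (f x))); last by apply/funext => x; rewrite SS.
  by apply: measurable_funD => //; exact: measurableT_comp.
have mE : measurable E.
  apply: bigcap_measurable => // M _; apply: bigcup_measurable => n _.
  exact: measurable_gt_cst.
have fE : f @^-1` E = E.
  apply/seteqP; split => x Ex M _.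
    have [n _ /= Mn] := Ex (Num.bound (M%:R + K)) I.
    exists n.+1 => //=; rewrite SS.
    have := gK x; rewrite ler_norml => /andP[Kx _].
    have M0 : 0 <= M%:R + K by rewrite addr_ge0// (le_trans _ (gK x)).
    have := archi_boundP M0; lra.
  have [[|n] _ /= Mn] := Ex (Num.bound (M%:R + K)) I.
    by move: Mn; rewrite /S big_ord0 ltNge ler0n.
  exists n => //=; move: Mn; rewrite SS.
  have := gK x; rewrite ler_norml => /andP[_ Kx].
  have M0 : 0 <= M%:R + K by rewrite addr_ge0// (le_trans _ (gK x)).
  have := archi_boundP M0; lra.
have bddE x : ~ E x -> exists M : R, forall n, S n x <= M.
  move=> nEx; apply: contrapT => h; apply: nEx => M _; apply: contrapT => h'.
  apply: h; exists M%:R => n; rewrite leNgt; apply/negP => Mn; apply: h'.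
  by exists n.
have [E0|E0] := ergf _ mE fE; first by exists E; split.
exfalso.
pose G n := [set x | F n x < 0].
have mG n : measurable (G n).
  by apply: measurable_lt_cst; exact: maxsum_measurable.
have GE : \bigcap_n G n `<=` ~` E.
  move=> x Gx Ex; have [[|n] _ /=] := Ex 0%N I.
    by rewrite /S big_ord0 ltxx.
  by move=> /lt_le_trans/(_ (birkhoff_sum_le _ _)); have /ltW := Gx n I; case: leP.
have muG n : (mu (G n) <= 1)%E by rewrite -mu1; apply: le_measure; rewrite ?inE.
have cvG : mu (G n) @[n --> \oo] --> 0%E.
  have <- : mu (\bigcap_n G n) = 0%E.
    apply/eqP; rewrite eq_le measure_ge0 andbT -E0; apply: le_measure => //; rewrite inE.
      exact: bigcap_measurable.
    exact: measurableC.
  apply: nonincreasing_cvg_mu => //.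
  - by rewrite (le_lt_trans (muG _))// ltry.
  - exact: bigcap_measurable.
  move=> m n mn; apply/subsetPset => x; rewrite /G /=; apply: le_lt_trans.
  elim: n mn => [|n IH]; first by rewrite leqn0 => /eqP ->.
  by rewrite leq_eqVlt => /predU1P[->//|/IH h]; exact: le_trans h (maxsum_le _ _).
have e0 : 0 < - (\int[mu]_x g x)%R / K by rewrite divr_gt0// oppr_gt0.
have fG n : mu (G n) \is a fin_num.
  by rewrite ge0_fin_numE// (le_lt_trans (muG _))// ltry.
have /fine_cvgP[_ /cvgr0Pnorm_lt /(_ _ e0) [n _ /(_ n (leqnn n))]] := cvG.
rewrite /= ger0_norm ?fine_ge0// ltr_pdivlMr// mulrC ltNge.
by rewrite maxsum_neg.
Qed.

End Birkhoff.

Section BirkhoffCesaro.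
Context {d} {T : measurableType d} {R : realType}.
Variable mu : {measure set T -> \bar R}.
Hypothesis mu1 : mu setT = 1%E.
Variable f : T -> T.
Hypothesis mf : measurable_fun setT f.
Hypothesis muf : forall A, measurable A -> mu (f @^-1` A) = mu A.
Hypothesis ergf : forall A, measurable A -> f @^-1` A = A ->
  mu A = 0%E \/ mu (~` A) = 0%E.

Lemma birkhoff_cesaro (h : T -> R) (K : R) : measurable_fun setT h ->
  (forall x, `|h x| <= K) -> exists N, [/\ measurable N, mu N = 0%E &
  forall x, ~ N x -> cesaro (fun i => h (iter i f x)) @ \oo --> (\int[mu]_x h x)%R].
Proof.
move=> mh hK; set l := Rintegral _ _ _.
have ih : mu.-integrable setT (EFin \o h) by exact: prob_integrable hK.
have icst (a : R) : mu.-integrable setT (EFin \o cst a).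
  by apply: (@prob_integrable _ _ _ _ mu1 _ `|a|).
have intcst (a : R) : (\int[mu]_x a = a)%R by rewrite Rintegral_cst// mu1 mulr1.
have bound (s : R) : `|s| = 1 -> exists N, [/\ measurable N, mu N = 0%E &
    forall x, ~ N x -> forall k : nat, exists M : R, forall n,
    \sum_(i < n) (s * h (iter i f x) - s * l - k.+1%:R^-1) <= M].
  move=> s1.
  (* Its integral is [- 1 / (k + 1)], which is negative; the signs [s = 1] and [s = -1] give the
     upper and the lower estimate. *)
  pose g k x := s * h x - (s * l + k.+1%:R^-1).
  have mshx : measurable_fun setT (fun x => s * h x) by exact: measurable_funM.
  have ish : mu.-integrable setT (EFin \o (fun x => s * h x)).
    exact: (integrableZl measurableT s ih).
  have gN k : exists N, [/\ measurable N, mu N = 0%E &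
     forall x, ~ N x -> exists M : R, forall n, \sum_(i < n) g k (iter i f x) <= M].
    have K0 : 0 < `|K| + `|l| + 1 by rewrite ltr_wpDl// addr_ge0.
    apply: (birkhoff_sum_bounded mu mu1 f mf muf ergf (g k) _ K0).
    - exact: measurable_funB.
    - move=> x; rewrite /g (le_trans (ler_normB _ _))// -addrA lerD//.
        by rewrite normrM s1 mul1r (le_trans (hK x))// ler_norm.
      rewrite (le_trans (ler_normD _ _))// lerD//.
        by rewrite normrM s1 mul1r.
      by rewrite ger0_norm// invf_le1// ler1n.
    rewrite /g RintegralB//; last exact: icst.
    rewrite intcst RintegralZl// -/l opprD addrA subrr sub0r oppr_lt0.
    by rewrite invr_gt0.
  have [N NP] := choice gN.
  exists (\bigcup_k N k); split.
  - by apply: bigcup_measurable => k _; case: (NP k).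
  - by apply: null_bigcup => k; case: (NP k).
  move=> x Nx k; have [_ _ /(_ x)] := NP k.
  case; first by move=> Nkx; apply: Nx; exists k.
  move=> M MP; exists M => n; have := MP n; rewrite /g.
  by under eq_bigr do rewrite opprD addrA.
have [N1 [mN1 N10 N1P]] := bound 1 (normr1 _).
have [N2 [mN2 N20 N2P]] := bound (-1) (normrN1 _).
exists (N1 `|` N2); split.
- exact: measurableU.
- by rewrite measureU0.
move=> x /not_orP[n1 n2]; apply: cesaro_of_sum_le => k.
  have [M MP] := N1P x n1 k; exists M => n; have := MP n.
  by under eq_bigr do rewrite !mul1r.
have [M MP] := N2P x n2 k; exists M => n; have := MP n.
by under eq_bigr do rewrite !mulN1r opprK [- _ + l]addrC.
Qed.

End BirkhoffCesaro.

Lemma full_measure_setC {d} {T : measurableType d} {R : realType}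
    (mu : {measure set T -> \bar R}) (A : set T) :
  mu setT = 1%E -> measurable A -> mu A = 1%E -> mu (~` A) = 0%E.
Proof.
move=> mu1 mA A1; have : mu setT = (mu A + mu (~` A))%E.
  by rewrite -measureU ?setUv ?setICr//; exact: measurableC.
rewrite mu1 A1 => /esym/eqP.
case: (mu (~` A)) => [r| |]//=; rewrite -EFinD eqe => /eqP h; congr (_%:E); lra.
Qed.

(** * Points with the right cell frequencies *)

Section GenericPoints.
Context {R : realType}.
Variable t : R.
Hypothesis t1 : 1 < t.
Hypothesis t2 : t <= 2.
Let f := ft t : measurableTypeR R -> measurableTypeR R.
Variable mu : {measure set (measurableTypeR R) -> \bar R}.
Hypothesis acip : acip_on_I (ft t) mu.
Local Notation leb := (@lebesgue_measure R).

Lemma ft_continuous : continuous (ft t).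
Proof.
rewrite (_ : ft t = (fun x : R => t * (x - 1) + 3) \min (fun x : R => t * (1 - x) - 1))//.
move=> x; apply: continuous_min.
  apply: cvgD; last exact: cvg_cst.
  by apply: cvgM; [exact: cvg_cst|apply: cvgB; [exact: cvg_id|exact: cvg_cst]].
apply: cvgB; last exact: cvg_cst.
by apply: cvgM; [exact: cvg_cst|apply: cvgB; [exact: cvg_cst|exact: cvg_id]].
Qed.

Lemma ft_measurable : measurable_fun setT f.
Proof. by apply: continuous_measurable_fun; exact: ft_continuous. Qed.

Lemma Iset_measurable : measurable (@Iset R : set (measurableTypeR R)).
Proof. exact: measurable_itv. Qed.

Lemma acip_null (A : set (measurableTypeR R)) : measurable A ->
  leb (`[-1, 1]%classic `&` A) = 0%E -> mu A = 0%E.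
Proof.
case: acip => mu1 muI /null_content_dominatesP mul muf mA l0.
have IA : mu (@Iset R `&` A) = 0%E.
  by apply: mul => //; apply: measurableI => //; exact: Iset_measurable.
apply/eqP; rewrite eq_le measure_ge0 andbT.
have nI := full_measure_setC _ _ mu1 Iset_measurable muI.
rewrite (@le_trans _ _ (mu (@Iset R `&` A `|` ~` @Iset R)))//.
  apply: le_measure; rewrite ?inE//.
    by apply: measurableU; [apply: measurableI => //|apply: measurableC]; exact: Iset_measurable.
  by move=> x Ax; have [Ix|Ix] := pselect (@Iset R x); [left|right].
rewrite measureU0 ?IA//; first by apply: measurableI => //; exact: Iset_measurable.
by apply: measurableC; exact: Iset_measurable.
Qed.

Lemma acip_ergodic (A : set (measurableTypeR R)) : measurable A -> f @^-1` A = A ->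
  mu A = 0%E \/ mu (~` A) = 0%E.
Proof.
move=> mA fA; have iA : @ft_invariant _ t A by move=> x _; rewrite -[in X in _ <-> X]fA.
have [h|h] := @tent_ergodic _ t t1 t2 A mA iA; [left|right]; apply: acip_null => //.
exact: measurableC.
Qed.

(** Half-open, so that each point of [I] lies in exactly one cell of a given mesh. The endpoint 1
    falls in the cell [j = 2 * (m + 1)], which explains the range of the sum in [step]. *)
Definition cell (m j : nat) : set R :=
  `[(-1 + j%:R / m.+1%:R), (-1 + j.+1%:R / m.+1%:R)[%classic.

Lemma cell_measurable m j : measurable (cell m j : set (measurableTypeR R)).
Proof. exact: measurable_itv. Qed.

Definition generic (x : R) := forall m j,
  cesaro (fun i => \1_(cell m j) (iter i (ft t) x) : R) @ \oo --> fine (mu (cell m j)).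

Lemma generic_points : exists G : set (measurableTypeR R),
  [/\ measurable G, G `<=` `[-1, 1]%classic, leb G != 0%E & G `<=` generic].
Proof.
case: (acip) => mu1 muI mul muf.
have mI := Iset_measurable.
have gN m j : exists N, [/\ measurable N, mu N = 0%E & forall x, ~ N x ->
    cesaro (fun i => \1_(cell m j) (iter i f x) : R) @ \oo --> fine (mu (cell m j))].
  have [||N [mN N0 NP]] :=
    @birkhoff_cesaro _ _ R mu mu1 f ft_measurable muf acip_ergodic (\1_(cell m j)) 1.
  - exact: measurable_indic (cell_measurable m j).
  - by move=> x; rewrite indicE; case: (_ \in _); rewrite ?normr1 ?normr0.
  exists N; split => // x /NP.
  rewrite /Rintegral integral_indic ?setIT//; exact: cell_measurable.
have [N NP] := choice (fun mj => gN mj.1 mj.2).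
pose NN := \bigcup_m \bigcup_j N (m, j).
have mNN : measurable NN.
  by apply: bigcup_measurable => m _; apply: bigcup_measurable => j _; case: (NP (m, j)).
have mG : measurable (@Iset R `\` NN : set (measurableTypeR R)) by exact: measurableD.
have NN0 : mu NN = 0%E.
  apply: null_bigcup => m; first by apply: bigcup_measurable => j _; case: (NP (m, j)).
  by apply: null_bigcup => j; case: (NP (m, j)).
exists (@Iset R `\` NN); split => //.
  (* A Lebesgue null set would be [mu]-null by absolute continuity, but [NN] is null and [I] has
     [mu]-measure 1. *)
  apply/negP => /eqP l0.
  have : mu (@Iset R `\` NN) = 0%E.
    by move/null_content_dominatesP : mul; exact.
  move=> h; have : (mu (@Iset R) <= mu (@Iset R `\` NN `|` NN))%E.
    apply: le_measure; rewrite ?inE//; first exact: measurableU.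
    by move=> x Ix; have [Nx|Nx] := pselect (NN x); [right|left].
  by rewrite measureU0// h muI lee_fin ler10.
move=> x [Ix nNx] m j; have [_ _ /(_ x)] := NP (m, j); apply.
by move=> Nx; apply: nNx; exists m => //; exists j.
Qed.
End GenericPoints.

(** * From cell frequencies to averages of continuous observables *)

Section Equidistribution.
Context {R : realType}.
Variable mu : {measure set (measurableTypeR R) -> \bar R}.
Hypothesis mu1 : mu setT = 1%E.
Variable v : nat -> R.
Hypothesis v1 : forall i, -1 <= v i <= 1.
Hypothesis v_freq : forall m j,
  cesaro (fun i => \1_(cell m j) (v i) : R) @ \oo --> fine (mu (cell m j)).

Definition step (m : nat) (b : nat -> R) (x : R) : R :=
  \sum_(j < (m.+1 * 2).+1) b j * \1_(cell m j) x.

Lemma step_cell m b (x : R) : -1 <= x <= 1 -> exists2 j, cell m j x & step m b x = b j.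
Proof.
move=> /andP[x1 x2].
have y0 : 0 <= (x + 1) * m.+1%:R by rewrite mulr_ge0//; lra.
have m0 : 0 < m.+1%:R :> R by rewrite ltr0n.
have cellE j : cell m j x <-> Num.truncn ((x + 1) * m.+1%:R) = j.
  rewrite /cell /= in_itv/= -lerBrDl -ltrBlDl opprK ler_pdivrMr// ltr_pdivlMr//.
  split => [h|<-]; last exact: truncn_itv.
  exact: truncn_def.
set j0 := Num.truncn _ in cellE.
have jK : (j0 < (m.+1 * 2).+1)%N.
  rewrite ltnS -(ler_nat R).
  have /andP[h _] := truncn_itv y0; apply: (le_trans h).
  by rewrite natrM mulrC ler_pM2l//; lra.
exists j0; first exact/cellE.
rewrite /step (bigD1 (Ordinal jK))//= big1 ?addr0.
  by rewrite indicE mem_set ?mulr1//; exact/cellE.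
move=> j jj; rewrite indicE memNset ?mulr0// => /cellE h.
by move/eqP: jj; apply; apply: val_inj; rewrite /= -h.
Qed.

Lemma cell_diam m j (x y : R) : cell m j x -> cell m j y -> `|x - y| <= m.+1%:R^-1.
Proof.
rewrite /cell /= !in_itv/= -[j.+1%:R]natr1 mulrDl mul1r ler_norml.
move: (m.+1%:R^-1 : R) => w; move: ((j%:R : R) * w) => z.
by move=> /andP[? ?] /andP[? ?]; lra.
Qed.

Lemma cesaro_step m b : cesaro (fun i => step m b (v i)) @ \oo -->
  \sum_(j < (m.+1 * 2).+1) b j * fine (mu (cell m j)).
Proof.
have -> : cesaro (fun i => step m b (v i)) = fun n =>
    \sum_(j < (m.+1 * 2).+1) b j * cesaro (fun i => \1_(cell m j) (v i) : R) n.
  apply/funext => n; rewrite /cesaro /step exchange_big mulr_suml.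
  by apply: eq_bigr => j _; rewrite mulrA -mulr_sumr.
apply: cvg_big => //; first exact: add_continuous.
move=> j _; apply: cvgM; first exact: cvg_cst.
exact: v_freq.
Qed.

Context {d} {X : measurableType d} (nu : {measure set X -> \bar R}).
Hypothesis nu1 : nu setT = 1%E.
Variable Y : set X.
Hypothesis mY : measurable Y.
Hypothesis Y0 : nu (~` Y) = 0%E.

Lemma full_measureI (P : set X) : measurable P -> nu (P `&` Y) = nu P.
Proof.
move=> mP; rewrite -[in RHS](setUIDK P Y) measureU0//.
- exact: measurableI.
- exact: measurableD.
apply/eqP; rewrite eq_le measure_ge0 andbT -Y0; apply: le_measure; rewrite ?inE//.
- exact: measurableD.
- exact: measurableC.
Qed.

Lemma cell_integrable m j (p : X -> R) : (forall m j, measurable (p @^-1` cell m j)) ->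
  nu.-integrable Y (EFin \o \1_(p @^-1` cell m j)).
Proof.
move=> mp; apply: (@integrableS _ _ _ _ setT) => //.
apply: (@prob_integrable _ _ _ _ nu1 _ 1); first exact: measurable_indic.
by move=> x; rewrite indicE; case: (_ \in _); rewrite ?normr1 ?normr0.
Qed.

Lemma stepE m b (p : X -> R) : EFin \o (fun y => step m b (p y)) =
  (fun y => \sum_(j < (m.+1 * 2).+1) (b j)%:E * (EFin \o \1_(p @^-1` cell m j)) y)%E.
Proof. by apply/funext => y /=; rewrite /step -sumEFin. Qed.

Lemma step_integrable m b (p : X -> R) : (forall m j, measurable (p @^-1` cell m j)) ->
  nu.-integrable Y (EFin \o (fun y => step m b (p y))).
Proof.
move=> mp; rewrite stepE; apply: integrable_sum => // j _; apply: integrableZl => //.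
exact: cell_integrable.
Qed.

Lemma step_integral m b (p : X -> R) : (forall m j, measurable (p @^-1` cell m j)) ->
  (forall m j, nu (p @^-1` cell m j) = mu (cell m j)) ->
  (\int[nu]_(y in Y) step m b (p y) = \sum_(j < (m.+1 * 2).+1) b j * fine (mu (cell m j)))%R.
Proof.
move=> mp nup; rewrite /Rintegral.
have -> : (fun y => (step m b (p y))%:E) = EFin \o (fun y => step m b (p y)) by [].
rewrite stepE integral_sum//; last first.
  by move=> j; apply: integrableZl => //; exact: cell_integrable.
have muE m' j : mu (cell m' j) = (fine (mu (cell m' j)))%:E.
  rewrite fineK// ge0_fin_numE// (@le_lt_trans _ _ 1%E) ?ltry// -mu1.
  by apply: le_measure; rewrite ?inE//; exact: cell_measurable.
under eq_bigr => j _.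
  rewrite integralZl//; last exact: cell_integrable.
  rewrite integral_indic// full_measureI// nup muE -EFinM.
  over.
by rewrite sumEFin.
Qed.

(* Along v, the values u (shifted by N) follow a: points whose p-coordinates
   (p y for y in Y, v i for u) are dl-close have e-close values. *)
Definition shadows (u : nat -> R) (a : X -> R) (e : R) : Prop :=
  exists N (p : X -> R) (dl : R), 0 < dl /\
  [/\ (forall m j, measurable (p @^-1` cell m j)),
      (forall m j, nu (p @^-1` cell m j) = mu (cell m j)),
      (forall y, Y y -> -1 <= p y <= 1),
      (forall y y', Y y -> Y y' -> `|p y - p y'| <= dl -> `|a y - a y'| <= e) &
      (forall i y, Y y -> `|v i - p y| <= dl -> `|u (i + N)%N - a y| <= e) /\
      (forall i i', `|v i - v i'| <= dl -> `|u (i + N)%N - u (i' + N)%N| <= e)].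

Variable a : X -> R.
Hypothesis ma : measurable_fun Y a.
Variable u : nat -> R.
Hypothesis ushadow : forall e : R, 0 < e -> shadows u a e.

Lemma step_approx (e : R) : 0 < e -> exists N (p : X -> R) m b,
  [/\ (forall m j, measurable (p @^-1` cell m j)),
      (forall m j, nu (p @^-1` cell m j) = mu (cell m j)),
      (forall y, Y y -> `|a y - step m b (p y)| <= e) &
      (forall i, `|u (i + N)%N - step m b (v i)| <= e)].
Proof.
move=> e0; have [N [p [dl [dl0 [mp nup p1 aa [ua uu]]]]]] := ushadow _ e0.
have [m mdl] : exists m : nat, m.+1%:R^-1 <= dl.
  exists (Num.bound dl^-1); rewrite -[leRHS]invrK lef_pV2 ?posrE ?invr_gt0// ltW//.
  by rewrite (lt_le_trans (archi_boundP _)) ?ler_nat// invr_ge0 ltW.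
(* A cell may be met by [p] on [Y] but not by [v], or conversely, so its value is sampled from
   either source. The default 0 below only occurs for cells met by neither. *)
pose V j := [set r | (exists y, [/\ Y y, cell m j (p y) & r = a y]) \/
   (exists i, cell m j (v i) /\ r = u (i + N)%N)].
pose b j := xget 0 (V j).
exists N, p, m, b; split => //.
  move=> y Yy; have [j jy ->] := step_cell m b (p y) (p1 y Yy).
  have : V j (b j) by apply: (@xgetI _ _ _ (a y)); left; exists y.
  case=> [[y' [Yy' jy' ->]]|[i [ji ->]]].
    by apply: aa => //; apply: le_trans mdl; exact: cell_diam jy jy'.
  by rewrite distrC; apply: ua => //; apply: le_trans mdl; exact: cell_diam ji jy.
move=> i; have [j ji ->] := step_cell m b (v i) (v1 i).
have : V j (b j) by apply: (@xgetI _ _ _ (u (i + N)%N)); right; exists i.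
case=> [[y' [Yy' jy' ->]]|[i' [ji' ->]]].
  by apply: ua => //; apply: le_trans mdl; exact: cell_diam ji jy'.
by apply: uu => //; apply: le_trans mdl; exact: cell_diam ji ji'.
Qed.

(** A step function within distance 1 of [a] shows that [a] is bounded on [Y]. *)
Lemma equidistributed_integrable : nu.-integrable Y (EFin \o a).
Proof.
have [N [p [m [b [mp nup ab _]]]]] := step_approx _ ltr01.
apply: measurable_bounded_integrable => //.
  by rewrite -[Y]setTI full_measureI// nu1 ltry.
exists (1 + \sum_(j < (m.+1 * 2).+1) `|b j|); split; first exact: num_real.
move=> M KM y Yy /=; apply: le_trans (ltW KM).
have := ab y Yy; have : `|step m b (p y)| <= \sum_(j < (m.+1 * 2).+1) `|b j|.
  apply: (le_trans (ler_norm_sum _ _ _)); apply: ler_sum => j _.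
  by rewrite normrM ler_piMr// indicE; case: (_ \in _); rewrite ?normr1 ?normr0.
have := ler_normD (a y - step m b (p y)) (step m b (p y)); rewrite subrK; lra.
Qed.

(** A single step function is close to [u] when read along [v] and close to [a] when read through
    [p]; its time average and its integral agree because both are given by the numbers
    [mu (cell m j)]. *)
Lemma equidistributed : cesaro u @ \oo --> (\int[nu]_(y in Y) a y)%R.
Proof.
apply: cesaro_approx => e e0.
have [N [p [m [b [mp nup ab ub]]]]] := step_approx _ e0.
have ia := equidistributed_integrable.
have ist := step_integrable m b p mp.
have id := integrableB mY ia ist.
exists N, (fun i => step m b (v i)), (\sum_(j < (m.+1 * 2).+1) b j * fine (mu (cell m j))).
split => //; first exact: cesaro_step.
rewrite -(step_integral _ _ _ mp nup) -RintegralB//.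
apply: (le_trans (le_normr_Rintegral _ _)) => //.
apply: (le_trans (@le_Rintegral _ _ _ _ Y _ (cst e) _ _ _ _)) => //.
- apply: integrable_norm; exact: id.
- apply: (@integrableS _ _ _ _ setT) => //.
  exact: (@prob_integrable _ _ _ _ nu1 _ `|e|).
by rewrite Rintegral_cst//= -[Y]setTI full_measureI// nu1 mulr1.
Qed.

End Equidistribution.

(** * The disk *)

Section Disk.
Context {R : realType}.
Local Notation leb := (@lebesgue_measure R).

Lemma cos_lip (x y : R) : cos x - cos y <= 1 * `|x - y|.
Proof.
wlog xy : x y / x <= y.
  move=> h; have [/h//|/ltW yx] := leP x y.
  have [z zyx] := @MVT_segment R cos (fun x => - sin x) y x yx (fun x _ => is_derive_cos x)
    (continuous_subspaceT (@continuous_cos R)).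
  move=> ->; rewrite mul1r [leRHS]ger0_norm ?subr_ge0//.
  by rewrite ler_piMl ?subr_ge0// lerNl sin_geN1.
have [z zyx] := @MVT_segment R cos (fun x => - sin x) x y xy (fun x _ => is_derive_cos x)
    (continuous_subspaceT (@continuous_cos R)).
move=> h; rewrite mul1r distrC [leRHS]ger0_norm ?subr_ge0// -opprB h mulNr opprK.
by rewrite ler_piMl ?subr_ge0// sin_le1.
Qed.

(** [G] is the image of this preimage under [cos], and a 1-Lipschitz map sends null sets to null
    sets. *)
Lemma cos_preimage_pos (G : set R) : G `<=` `[-1, 1]%classic -> leb G != 0%E ->
  leb ((@cos R) @^-1` G `&` `[0, pi]%classic) != 0%E.
Proof.
move=> GI; apply: contra_neq => h0.
apply/eqP; rewrite eq_le leb_ge0 andbT -(mule0 1%:E) -h0.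
have {1}-> : G = @cos R @` (@cos R @^-1` G `&` `[0, pi]%classic).
  apply/seteqP; split => [x Gx|_ [y [Gy _] <-]//].
  have xI := GI _ Gx; move: (xI); rewrite /= in_itv/= => xI'.
  exists (acos x); last by rewrite acosK.
  by split; rewrite /= ?in_itv/= ?acosK// acos_ge0// acos_lepi.
by apply: leb_image_lip => // x y _ _; exact: cos_lip.
Qed.

Lemma pos_comb_neq0 (p q x y : R) : 0 < p -> 0 < q -> 0 <= x -> 0 <= y -> x + y = 1 ->
  p * x + q * y <> 0.
Proof.
move=> p0 q0 x0 y0 xy /eqP; rewrite paddr_eq0 ?mulr_ge0// ?ltW//.
by rewrite !mulf_eq0 (gt_eqF p0) (gt_eqF q0)/= => /andP[/eqP hx /eqP hy]; lra.
Qed.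

(* The level curves of s are nested ellipses with semi-axes 2 - s and 2(1 - s). *)
Lemma phi_lt_absurd (c c' : R * R) : Cbox c -> Cbox c' -> c.2 < c'.2 -> phi c <> phi c'.
Proof.
move=> [_ /andP[s0 s1]] [_ /andP[s0' s1']] ss [].
set s := c.2 in ss s0 s1 *; set s' := c'.2 in ss s0' s1' *.
have := cos2Dsin2 c.1; have := cos2Dsin2 c'.1.
move: (cos c.1) (sin c.1) (cos c'.1) (sin c'.1) => x v x' v' h' h e1 e2.
have e2' : (1 - s) * v = (1 - s') * v'.
  by move: e2; rewrite -!mulrA => /mulfI; apply; rewrite pnatr_eq0.
have E : (2 - s) ^+ 2 * (1 - s) ^+ 2 =
    ((2 - s) * x) ^+ 2 * (1 - s) ^+ 2 + ((1 - s) * v) ^+ 2 * (2 - s) ^+ 2.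
  by rewrite -[LHS]mulr1 -h; ring.
rewrite e1 e2' in E.
have p1 : 0 < 1 - s by lra.
have p2 : 0 < 2 - s by lra.
have p3 : 0 <= 1 - s' by lra.
have p4 : 0 < 2 - s' by lra.
have q1 : (1 - s') ^+ 2 < (1 - s) ^+ 2 by rewrite ltrXn2r//; lra.
have q2 : (2 - s') ^+ 2 < (2 - s) ^+ 2 by rewrite ltrXn2r//; lra.
have P : 0 < ((2 - s) ^+ 2 - (2 - s') ^+ 2) * (1 - s) ^+ 2.
  by rewrite mulr_gt0 ?subr_gt0// exprn_gt0.
have Q : 0 < ((1 - s) ^+ 2 - (1 - s') ^+ 2) * (2 - s) ^+ 2.
  by rewrite mulr_gt0 ?subr_gt0// exprn_gt0.
apply: (pos_comb_neq0 _ _ _ _ P Q (sqr_ge0 x') (sqr_ge0 v') h').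
transitivity ((2 - s) ^+ 2 * (1 - s) ^+ 2 * (x' ^+ 2 + v' ^+ 2) -
    (((2 - s') * x') ^+ 2 * (1 - s) ^+ 2 + ((1 - s') * v') ^+ 2 * (2 - s) ^+ 2)).
  by ring.
by rewrite -E h' mulr1 subrr.
Qed.

(** At [s = 1] angles with equal cosine are glued, hence the strict bound. Cosine and sine suffice
    because [phi] sees the angle only through them; this also makes [Upsilon] independent of the
    preimage that [coords] picks. *)
Lemma phi_inj (c c' : R * R) : Cbox c -> Cbox c' -> c.2 < 1 -> phi c = phi c' ->
  [/\ c.2 = c'.2, cos c.1 = cos c'.1 & sin c.1 = sin c'.1].
Proof.
move=> bc bc' c1 e.
have e2 : c.2 = c'.2.
  apply/eqP; rewrite eq_le !leNgt; apply/andP; split; apply/negP => h.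
    by have /nesym := phi_lt_absurd _ _ bc' bc h.
  exact: (phi_lt_absurd _ _ bc bc' h).
case: e; rewrite -e2 => h1 h2; split => //.
  by move: h1 => /mulfI; apply; rewrite gt_eqF//; case: bc => _; lra.
by move: h2 => /mulfI; apply; rewrite gt_eqF// mulr_gt0// subr_gt0.
Qed.

Lemma Upsilon_phi (c : R * R) : Cbox c -> c.2 < 1 ->
  Upsilon (phi c) = phi (c.1, Num.min (2 * c.2) 1).
Proof.
move=> bc c1; have := @xgetPex _ (0, 0) [set c' | Cbox c' /\ phi c' = phi c].
rewrite -/(coords (phi c)) => h; have [bc' e] := h (ex_intro _ c (conj bc erefl)).
have [e2 ec es] := phi_inj _ _ bc bc' c1 (esym e).
move: bc' e e2 ec es; rewrite /Upsilon; move: (coords _) => c' bc' e e2 ec es.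
by rewrite /phi/= -e2 ec es.
Qed.

Lemma phi_top (y : R) : phi (y, 1) = inI (cos y).
Proof. by rewrite /phi /inI/= subrr mulr0 mul0r; congr (_, _); ring. Qed.

Lemma inI_Dset (x : R) : -1 <= x <= 1 -> Dset (inI x).
Proof.
move=> xI; exists (acos x, 1); last by rewrite phi_top acosK.
split => /=; rewrite ?ler01 ?lexx// acos_ge0//= (le_lt_trans (acos_lepi xI))//.
by have := @pi_gt0 R; lra.
Qed.

Section Unwrapping.
Variables (fb : R -> R * R -> R * R) (t : R).
Hypothesis ufb : unwrapping fb.
Hypothesis fbid : forall t, Jset t -> forall c, Cbox c -> c.2 <= 3 / 4 -> fb t (phi c) = phi c.
Hypothesis Jt : Jset t.
Let H := Ht fb t.

Lemma Ht_inI (x : R) : -1 <= x <= 1 -> H (inI x) = inI (ft t x).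
Proof. by move=> xI; have [_ /(_ t Jt)[_ _ _ h _]] := ufb; rewrite /H /Ht /= h. Qed.

Lemma Ht_phi c : Cbox c -> c.2 <= 3 / 4 -> H (phi c) = phi (c.1, Num.min (2 * c.2) 1).
Proof.
move=> bc c34; rewrite /H /Ht /= fbid// Upsilon_phi//.
by apply: le_lt_trans c34 _; lra.
Qed.

Lemma Jset_itv : 1 < t <= 2. Proof. by move: Jt; rewrite /Jset /= in_itv. Qed.

Lemma iter_Ht_inI n (x : R) : -1 <= x <= 1 -> iter n H (inI x) = inI (iter n (ft t) x).
Proof.
move=> xI; elim: n => //= n ->; rewrite Ht_inI//.
have /andP[t1 t2] := Jset_itv; exact: iter_ft_itv.
Qed.

Definition annulus (G : set R) : set (R * R) :=
  @phi R @` [set c | Cbox c /\ G (cos c.1) /\ 1 / 2 <= c.2 <= 3 / 4].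

Lemma annulus_pos (G : set (measurableTypeR R)) : measurable G -> G `<=` `[-1, 1]%classic ->
  leb G != 0%E -> positive_dyds (annulus G).
Proof.
move=> mG GI G0.
pose Y : set (measurableTypeR R) := @cos R @^-1` G `&` `[0, 2 * pi[%classic.
have mY : measurable Y.
  apply: measurableI => //; rewrite -[X in measurable X]setTI.
  by apply: (continuous_measurable_fun (@continuous_cos R)).
pose Z : set (measurableTypeR R) := `[(1 / 2), (3 / 4)]%classic.
have -> : positive_dyds (annulus G) =
    (measurable (Y `*` Z) /\ (0 < (@lebesgue_measure R \x @lebesgue_measure R) (Y `*` Z))%E).
  (* Since [s <= 3 / 4 < 1] on the annulus, [phi_inj] applies and the pullback to coordinates is an
     exact product. *)
  rewrite /positive_dyds; suff -> : @Cbox R `&` @phi R @^-1` annulus G = Y `*` Z by [].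
  apply/seteqP; split => [c [bc [c' [bc' [Gc' s']] e]]|c [[Gc]]].
    have [|e2 ec es] := phi_inj _ _ bc' bc _ e; first by move: s'; lra.
    move: bc => [cy cs]; split.
      by split; [rewrite /= -ec|rewrite /= in_itv].
    by rewrite /Z /= in_itv/= -e2.
  rewrite /Z /= !in_itv/= => cy cs.
  have bc : Cbox c by split=> //; lra.
  by split => //; exists c.
have mZ : measurable Z by exact: measurable_itv.
split; first exact: measurableX.
rewrite product_measure1E//.
rewrite mule_gt0//; last first.
  change (0 < leb Z)%E.
  by rewrite /Z lebesgue_measure_itv/= lte_fin ifT ?lte_fin; lra.
change (0 < leb Y)%E; rewrite lt0e leb_ge0 andbT.
have := @cos_preimage_pos G GI G0; apply: contra_neq => h0.
apply/eqP; rewrite eq_le leb_ge0 andbT -h0; apply: leb_le => y [Gy].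
rewrite /= in_itv/= => /andP[y0 yp]; split => //=; rewrite in_itv/= y0 (le_lt_trans yp)//.
by have := @pi_gt0 R; lra.
Qed.

End Unwrapping.
End Disk.

Lemma birkhoff_cvg {T : Type} {R : realType} (F : T -> T) (a : T -> R) (z : T)
    (l : \bar R) (r : R) :
  l = r%:E -> cesaro (fun i => a (iter i F z)) @ \oo --> r ->
  (fun n => (birkhoff F a z n)%:E) @ \oo --> l.
Proof. by move=> -> h; apply: cvg_EFin => //; exact: nearW. Qed.

(** * Limits along ultrafilters, in place of convergent subsequences *)

Lemma ultrafilter_cofinal : exists2 U : set_system nat, UltraFilter U & \oo `<=` U.
Proof. by have [U [UU sU]] := ultraFilterLemma eventually_filter; exists U. Qed.

Lemma fmap_ultra {X Y : Type} (U : set_system X) (f : X -> Y) :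
  UltraFilter U -> UltraFilter (f @ U).
Proof.
move=> UU; split; first exact: fmap_proper_filter.
move=> G GP sG; apply/seteqP; split => A; last exact: sG.
move=> GA; have [//|UA] := in_ultra_setVsetC (f @^-1` A) UU.
have [y [Ay nAy]] := @filter_ex _ G _ _ (filterI GA (sG (~` A) UA)).
by exfalso; exact: nAy.
Qed.

Lemma lim_unique_of_diff {R : realType} (U : set_system nat) (x x' : nat -> R) (p p' : R) :
  ProperFilter U -> \oo `<=` U -> x @ U --> p -> x' @ U --> p' ->
  (fun n => x n - x' n) @ \oo --> 0 -> p = p'.
Proof.
move=> PU sU xp xp' h; apply/eqP; rewrite -subr_eq0; apply/eqP.
have h0 : (fun n => x n - x' n) @ U --> 0 by apply: cvg_trans h; exact: cvg_app.
have hp : (fun n => x n - x' n) @ U --> p - p' by exact: cvgB.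
exact: (cvg_unique _ hp h0).
Qed.

Lemma lim_itv {R : realType} (U : set_system nat) (x : nat -> R) (p : R) :
  ProperFilter U -> x @ U --> p -> U (x @^-1` `[-1, 1]%classic) -> `[-1, 1]%classic p.
Proof.
move=> PU xp Ux.
have cl : closed (`[-1, 1]%classic : set R) by exact: itv_closed.
by apply: (@closed_cvg _ R U PU x _ cl _ p xp).
Qed.

Lemma cvg0_of_le_harmonic {R : realType} (x : nat -> R) (j : nat) :
  (forall n, (j <= n)%N -> `|x n| <= n.+1%:R^-1) -> x @ \oo --> 0.
Proof.
move=> h; apply/cvgr0Pnorm_lt => e e0; near=> n.
have jn : (j <= n)%N by near: n; exists j.
apply: (le_lt_trans (h n jn)); near: n; exact: near_infty_natSinv_lt (PosNum e0).
Unshelve. all: by end_near. Qed.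

(** One ultrafilter makes both sequences converge in the compact set [C], and continuity at the
    common limit brings the values together. Keeping [D] apart from [C] means that only this limit
    has to be placed in [D]. *)
Lemma close_values {T : topologicalType} {R : realType} (C D : set T) (a : T -> R)
    (w w' : nat -> T) (e : R) :
  compact C -> {within D, continuous a} -> 0 < e ->
  (forall n, C (w n)) -> (forall n, C (w' n)) ->
  (forall n, D (w n)) -> (forall n, D (w' n)) ->
  (forall (U : set_system nat) p p', UltraFilter U -> \oo `<=` U ->
     w @ U --> p -> w' @ U --> p' -> p = p' /\ D p) ->
  exists n, `|a (w n) - a (w' n)| < e.
Proof.
move=> cC ca e0 Cw Cw' Dw Dw' lim.
have [U UU sU] := ultrafilter_cofinal.
have cU (x : nat -> T) : (forall n, C (x n)) -> exists p : T, x @ U --> p.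
  move=> Cx; move: cC; rewrite compact_ultra => /(_ _ (fmap_ultra U x UU)).
  have UC : (x @ U) C by apply: (@filterE _ U).
  by move=> /(_ UC)[p [_ xp]]; exists p.
have [p wp] := cU _ Cw; have [p' wp'] := cU _ Cw'.
have [pp Dp] := lim U p p' UU sU wp wp'; rewrite -pp in wp'.
have e20 : 0 < e / 2 by rewrite divr_gt0.
have ap : \forall x \near within D (nbhs p), `|a p - a x| < e / 2.
  by have /subspace_continuousP/(_ p Dp)/cvgrPdist_lt/(_ _ e20) := ca.
have h1 : U (fun n => D (w n) -> `|a p - a (w n)| < e / 2) := wp _ ap.
have h2 : U (fun n => D (w' n) -> `|a p - a (w' n)| < e / 2) := wp' _ ap.
have [n [/(_ (Dw n)) h /(_ (Dw' n)) h']] := @filter_ex _ U _ _ (filterI h1 h2).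
exists n; move: h h'; rewrite !ltr_norml; lra.
Qed.

Lemma inI_continuous {R : realType} : continuous (@inI R).
Proof.
move=> x; apply: (@cvg_pair _ _ _ (nbhs x) (nbhs x) (nbhs (0 : R)) _ _ _ id (cst 0)).
  exact: cvg_id.
exact: cvg_cst.
Qed.

(** * The basin in the disk *)

Section RegularD.
Context {R : realType}.
Variables (fb : R -> R * R -> R * R) (t : R).
Hypothesis ufb : unwrapping fb.
Hypothesis fbid : forall t, Jset t -> forall c, Cbox c -> c.2 <= 3 / 4 -> fb t (phi c) = phi c.
Hypothesis Jt : Jset t.
Let H := Ht fb t.
Variable mu : {measure set (measurableTypeR R) -> \bar R}.
Hypothesis acip : acip_on_I (ft t) mu.

Lemma annulus_regular (G : set R) z : G `<=` generic t mu -> annulus G z -> regular_D H mu z.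
Proof.
move=> Gg [c [bc [Gc /andP[s1 s2]]] <-]; split; first by exists c.
move=> a ca.
have x1 : -1 <= cos c.1 <= 1 by rewrite cos_geN1 cos_le1.
have v1 n : -1 <= iter n (ft t) (cos c.1) <= 1.
  have /andP[t1 t2] := Jset_itv t Jt; exact: iter_ft_itv.
have Hc : H (phi c) = inI (cos c.1).
  by rewrite /H (Ht_phi fb t fbid Jt)// min_r ?phi_top//; lra.
have caI : {within `[-1, 1]%classic, continuous (a \o @inI R)}.
  apply/subspace_continuousP => x /=; rewrite in_itv/= => xI.
  have := (subspace_continuousP _ _).1 ca (inI x) (inI_Dset x xI).
  move=> h; apply: (cvg_trans _ h) => P /= hP.
  change (nbhs x (fun x' => `[-1, 1]%classic x' -> P (a (inI x')))).
  have := inI_continuous x _ hP; apply: (@filterS _ (nbhs x)) => x' {}h.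
  rewrite /= in_itv/= => xI'.
  exact: h (inI_Dset x' xI').
have mu1 : mu setT = 1%E by case: acip.
have muI : mu (~` @Iset R) = 0%E.
  by apply: full_measure_setC => //; [exact: Iset_measurable|case: acip].
have ma : measurable_fun (@Iset R : set (measurableTypeR R)) (a \o @inI R).
  by apply: subspace_continuous_measurable_fun => //; exact: Iset_measurable.
have shad (e : R) : 0 < e ->
    shadows mu (fun i => iter i (ft t) (cos c.1)) mu (@Iset R)
      (fun i => a (iter i H (phi c))) (a \o @inI R) e.
  move=> e0.
  have [dl dl0 uc] : exists2 dl : R, 0 < dl & forall y y' : R, -1 <= y <= 1 -> -1 <= y' <= 1 ->
      `|y - y'| <= dl -> `|a (inI y) - a (inI y')| <= e.
    apply: contrapT => nuc.
    have bad n : exists yy : R * R, [/\ -1 <= yy.1 <= 1, -1 <= yy.2 <= 1,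
       `|yy.1 - yy.2| <= n.+1%:R^-1 & e < `|a (inI yy.1) - a (inI yy.2)|].
      apply: contrapT => h; apply: nuc; exists n.+1%:R^-1; first by rewrite invr_gt0.
      move=> y y' Iy Iy' yy'; rewrite leNgt; apply/negP => eyy.
      by apply: h; exists (y, y').
    have [yy yyP] := choice bad.
    have [|||||n] := @close_values R R `[-1, 1]%classic `[-1, 1]%classic (a \o @inI R)
      (fun n => (yy n).1) (fun n => (yy n).2) e (@segment_compact _ _ _) caI e0.
    - by move=> n; rewrite /= in_itv/=; case: (yyP n).
    - by move=> n; rewrite /= in_itv/=; case: (yyP n).
    - by move=> n; rewrite /= in_itv/=; case: (yyP n).
    - by move=> n; rewrite /= in_itv/=; case: (yyP n).
    - move=> U p p' UU sU wp wp'; split.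
        apply: (@lim_unique_of_diff R U _ _ _ _ _ sU wp wp').
        by apply: (@cvg0_of_le_harmonic _ _ 0) => n _; case: (yyP n).
      apply: (@lim_itv R U _ _ _ wp) => //.
      by apply: (@filterE _ U) => n; rewrite /= in_itv/=; case: (yyP n).
    have [_ _ _] := yyP n; rewrite /=; lra.
  have E i : iter (i + 1) H (phi c) = inI (iter i (ft t) (cos c.1)).
    by rewrite addn1 iterSr Hc iter_Ht_inI.
  (* The orbit enters [I] after one step, hence the shift 1, and is the tent orbit from then on,
     hence the identity as coordinate. *)
  exists 1%N, id, dl; split => //; split => //.
    by move=> m j; exact: cell_measurable.
  split; first by move=> i y Iy; rewrite E; apply: uc => //; rewrite /Iset /= in_itv in Iy.
  by move=> i i'; rewrite !E; exact: uc.
have := equidistributed mu mu1 _ v1 (Gg _ Gc) mu mu1 _ Iset_measurable muI _ ma _ shad.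
have := equidistributed_integrable mu _ v1 mu mu1 _ Iset_measurable muI _ ma _ shad.
move=> ia; apply: birkhoff_cvg.
by rewrite /Rintegral fineK//; apply: integrable_fin_num ia; exact: Iset_measurable.
Qed.
End RegularD.

(** * The natural extension *)

(* D need not be measurable, nor g measurable on D: Dhat is only known to
   contain the closed set Ihat. *)
Section IntegralFull.
Local Open Scope ereal_scope.
Context {d} {X : measurableType d} {R : realType}.
Variable nu : {measure set X -> \bar R}.
Variables Y D : set X.
Hypothesis mY : measurable Y.
Hypothesis Y0 : nu (~` Y) = 0.
Hypothesis YD : Y `<=` D.
Import HBNNSimple.

(** The integral of a nonnegative function is a supremum over simple functions below it, whatever
    the domain; cutting such a function down to [Y] keeps its integral, since the complement of [Y]
    is null. *)
Lemma ge0_integral_full (g : X -> \bar R) : (forall x, 0 <= g x) ->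
  \int[nu]_(x in D) g x = \int[nu]_(x in Y) g x.
Proof.
move=> g0; rewrite !ge0_integralE//; apply/eqP; rewrite eq_le; apply/andP; split.
  apply: ge_ereal_sup => _ [h hg <-] /=.
  apply: (@le_trans _ _ (sintegral nu (proj_nnsfun h mY))); last first.
    apply: ereal_sup_ubound; exists (proj_nnsfun h mY) => // x /=.
    rewrite patchE mindicE.
    have [xY|xY] := boolP (x \in Y); last by rewrite mulr0.
    rewrite mulr1 (le_trans (hg x))// patchE ifT//.
    by rewrite inE; apply: YD; rewrite inE in xY.
  rewrite -!integralT_nnsfun.
  rewrite (ge0_negligible_integral (measurableC mY)) ?setTD ?setCK//.
  - rewrite integral_mkcond le_eqVlt; apply/orP; left; apply/eqP.
    apply: eq_integral => x _; rewrite patchE /= mindicE.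
    by case: (x \in Y); rewrite ?mulr1 ?mulr0.
  - exact/measurable_EFinP.
  - by move=> x _; rewrite lee_fin.
apply: ge_ereal_sup => _ [h hg <-] /=; apply: ereal_sup_ubound; exists h => // x.
apply: (le_trans (hg x)); rewrite !patchE.
case: ifPn => xY; case: ifPn => xD //.
by exfalso; move: xY xD; rewrite inE notin_setE => /YD.
Qed.

Lemma integral_full (g : X -> \bar R) :
  \int[nu]_(x in D) g x = \int[nu]_(x in Y) g x.
Proof.
by rewrite integralE [RHS]integralE; congr (_ - _); apply: ge0_integral_full => x;
  rewrite ?funepos_ge0 ?funeneg_ge0.
Qed.
End IntegralFull.

Section Threads.
Context {R : realType}.
Local Notation Th := (Thr R).
Local Notation ThM := (ThrM R).

Lemma thr_open_measurable (A : set Th) : open A -> measurable (A : set ThM).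
Proof. by move=> oA; exact: sub_sigma_algebra. Qed.

Lemma thr_continuous_measurable (D : set Th) (a : Th -> R) :
  measurable (D : set ThM) -> {within D, continuous a} ->
  measurable_fun (D : set ThM) (a : ThM -> R).
Proof.
move=> mD /continuousP ca; apply: (measurability _ (RGenOpens.measurableE R)).
move=> _ [_ [x [y ->] <-]].
have /open_subspaceP[V oV VD] : open (from_subspace D a @^-1` `]x, y[%classic).
  exact/ca/interval_open.
rewrite setIC -VD; apply: measurableI => //; exact: thr_open_measurable.
Qed.

Lemma thr_proj_continuous (n : nat) : continuous (fun w : Th => w n).
Proof. exact: (@proj_continuous nat (fun=> (R * R)%type) n). Qed.

End Threads.

(** * The basin in the inverse limit *)

Section RegularHat.
Context {R : realType}.
Variables (fb : R -> R * R -> R * R) (t : R).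
Hypothesis ufb : unwrapping fb.
Hypothesis fbid : forall t, Jset t -> forall c, Cbox c -> c.2 <= 3 / 4 -> fb t (phi c) = phi c.
Hypothesis Jt : Jset t.
Let H := Ht fb t.
Variable mu : {measure set (measurableTypeR R) -> \bar R}.
Hypothesis acip : acip_on_I (ft t) mu.
Variable nu : {measure set (ThrM R) -> \bar R}.
Hypothesis hnu : hat_measure H mu nu.
Local Notation Th := (Thr R).
Local Notation ThM := (ThrM R).

Lemma ft_lip (x y : R) : `|ft t x - ft t y| <= 2 * `|x - y|.
Proof.
have /andP[t1 t2] := Jset_itv t Jt.
have t0 : 0 <= t by lra.
apply: (@le_trans _ _ (t * `|x - y|)); last by rewrite ler_wpM2r.
have h1 : `|(t * (x - 1) + 3) - (t * (y - 1) + 3)| = t * `|x - y|.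
  by rewrite -[t in RHS]ger0_norm// -normrM; congr (`|_|); ring.
have h2 : `|(t * (1 - x) - 1) - (t * (1 - y) - 1)| = t * `|x - y|.
  by rewrite -[t in RHS]ger0_norm// -normrM -normrN; congr (`|_|); ring.
rewrite /ft; move: h1 h2.
move: (t * (x - 1) + 3) (t * (1 - x) - 1) (t * (y - 1) + 3) (t * (1 - y) - 1)
  (t * `|x - y|) => p q p' q' m h1 h2.
have := ler_norm (p - p'); have := ler_norm (q - q').
have := ler_norm (p' - p); have := ler_norm (q' - q).
rewrite [`|p' - p|]distrC [`|q' - q|]distrC h1 h2 ler_norml.
by case: (leP p q) => ?; case: (leP p' q') => ?; lra.
Qed.

Definition threadI (n : nat) : set Th :=
  [set w | [/\ -1 <= (w n.+1).1 <= 1, (w n.+1).2 = 0 & w n = inI (ft t (w n.+1).1)]].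

(** This is the inverse limit of [ft t] on [I], written as a countable family of conditions on
    coordinates so that it is visibly Borel. *)
Definition Ihat : set Th := \bigcap_n threadI n.

Lemma Ihat_itv w n : Ihat w -> -1 <= (w n).1 <= 1 /\ w n = inI (w n).1.
Proof.
have /andP[t1 t2] := Jset_itv t Jt.
move=> Iw; have [h1 h2 h3] := Iw n I.
by rewrite h3 /=; split => //; exact: ft_itv.
Qed.

Lemma Ihat_Dhat : Ihat `<=` Dhat H.
Proof.
move=> w Iw n; have [nI nE] := Ihat_itv w n Iw; split; first by rewrite nE; exact: inI_Dset.
have [mI mE] := Ihat_itv w n.+1 Iw.
by rewrite mE /H (Ht_inI fb t ufb Jt)//; case: (Iw n I).
Qed.

Lemma threadI_measurable n : measurable (threadI n : set ThM).
Proof.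
have mp (k : nat) (g : R * R -> R) : continuous g ->
    measurable_fun (setT : set ThM) (fun w : ThM => g (w k)).
  move=> cg; apply: thr_continuous_measurable => //; apply: continuous_subspaceT => w.
  by apply: continuous_comp; [exact: thr_proj_continuous|exact: cg].
have c1 : continuous (fun p : R * R => p.1) by move=> p; exact: cvg_fst.
have c2 : continuous (fun p : R * R => p.2) by move=> p; exact: cvg_snd.
have cf : continuous (fun p : R * R => ft t p.1).
  by move=> p; apply: continuous_comp; [exact: c1|exact: ft_continuous].
have -> : threadI n =
   (setT `&` (fun w : Th => (w n.+1).1) @^-1` `[-1, 1]%classic) `&`
   (setT `&` (fun w : Th => (w n.+1).2) @^-1` [set 0]) `&`
   ((setT `&` (fun w : Th => (w n).1 - ft t (w n.+1).1) @^-1` [set 0]) `&`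
   (setT `&` (fun w : Th => (w n).2) @^-1` [set 0])).
  apply/seteqP; split => w; rewrite /threadI /=.
    by case=> h1 h2 h3; rewrite in_itv/= h1 h3/= subrr.
  rewrite in_itv/= => -[[[_ h1] [_ h2]] [[_ /eqP]]]; rewrite subr_eq0 => /eqP h3 [_ h4].
  by split => //; case: (w n) h3 h4 => x y /= -> ->.
apply: measurableI; apply: measurableI.
- exact: (mp n.+1 _ c1).
- exact: (mp n.+1 _ c2).
- have : measurable_fun (setT : set ThM) (fun w : ThM => (w n).1 - ft t (w n.+1).1).
    by apply: measurable_funB; [exact: (mp n _ c1)|exact: (mp n.+1 _ cf)].
  exact.
- exact: (mp n _ c2).
Qed.

(* By invariance it suffices to treat threadI 0, whose preimage under Hhat only
   says that the 0-th coordinate lies in I. *)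
Lemma threadI_full n : nu (threadI n) = 1%E.
Proof.
case: hnu => nu1 _ nuH nup.
elim: n => [|n <-]; last by rewrite -(nuH _ (threadI_measurable _)).
rewrite -(nuH _ (threadI_measurable _)).
pose A : set (measurableTypeR R * measurableTypeR R) := @Iset R `*` [set 0].
have mA : measurable A by apply: measurableX => //; exact: Iset_measurable.
have -> : Hhat H @^-1` threadI 0 = [set z : ThrM R | A (z 0%N)].
  apply/seteqP; split => z; rewrite /threadI /A /Iset /= in_itv/=; first by case.
  case=> h1 h2; split => //.
  rewrite -(Ht_inI fb t ufb Jt)//; congr (H _).
  by case: (z 0%N) h2 => x y /= ->.
rewrite nup// (_ : _ @^-1` _ = @Iset R); first by case: acip.
by apply/seteqP; split => x /=; [case|].
Qed.

Lemma Ihat_measurable : measurable (Ihat : set ThM).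
Proof. by apply: bigcap_measurable => // n _; exact: threadI_measurable. Qed.

Lemma Ihat_full : nu (~` Ihat) = 0%E.
Proof.
case: hnu => nu1 _ nuH nup.
rewrite /Ihat setC_bigcap; apply: null_bigcup => n.
  by apply: measurableC; exact: threadI_measurable.
apply: full_measure_setC => //; first exact: threadI_measurable.
exact: threadI_full.
Qed.

Lemma Dset_box (p : R * R) : Dset p -> (`[-2, 2]%classic `*` `[-2, 2]%classic) p.
Proof.
move=> [c [_ /andP[s0 s1]] <-]; rewrite /phi; split; rewrite /= in_itv/= -ler_norml normrM.
  rewrite -[leRHS]mulr1; apply: ler_pM => //; last exact: cos_max.
  by rewrite ler_norml; lra.
rewrite -[leRHS]mulr1; apply: ler_pM => //; last by rewrite ler_norml sin_geN1 sin_le1.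
by rewrite ler_norml; lra.
Qed.

Definition thread_box : set Th :=
  [set w | forall n, (`[-2, 2]%classic `*` `[-2, 2]%classic) (w n)].

Lemma thread_box_compact : compact thread_box.
Proof.
apply: (@tychonoff nat (fun=> (R * R)%type)
  (fun=> `[-2, 2]%classic `*` `[-2, 2]%classic)) => _.
by apply: compact_setX; exact: segment_compact.
Qed.

(** Coordinates of smaller index are forward images under [H], which maps [I] into itself. *)
Lemma Dhat_at_I w n : Dhat H w -> IinD (w n) ->
  forall j, (j <= n)%N -> -1 <= (w j).1 <= 1 /\ w j = inI (w j).1.
Proof.
have /andP[t1 t2] := Jset_itv t Jt.
move=> Dw; elim: n => [|n IH] [x xI wx] j.
  by rewrite leqn0 => /eqP ->; rewrite -wx /=; move: xI; rewrite /Iset /= in_itv.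
move: xI; rewrite /Iset /= in_itv/= => xI.
rewrite leq_eqVlt => /predU1P[->|]; first by rewrite -wx.
rewrite ltnS; apply: IH; have [_ <-] := Dw n; rewrite -wx /H (Ht_inI fb t ufb Jt)//.
by exists (ft t x) => //; rewrite /Iset /= in_itv/=; exact: ft_itv.
Qed.

Lemma Dhat_ft w n : Dhat H w -> -1 <= (w n.+1).1 <= 1 -> w n.+1 = inI (w n.+1).1 ->
  (w n).1 = ft t (w n.+1).1.
Proof. by move=> Dw wI wE; have [_ <-] := Dw n; rewrite wE /H (Ht_inI fb t ufb Jt). Qed.

Lemma Dhat_contract w w' n : Dhat H w -> Dhat H w' -> IinD (w n) -> IinD (w' n) ->
  forall j, (j <= n)%N -> `|(w j).1 - (w' j).1| <= 2 ^+ (n - j) * `|(w n).1 - (w' n).1|.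
Proof.
move=> Dw Dw' In In' j jn.
rewrite -{1 2}(subKn jn); have := leq_subr j n; elim: (n - j)%N => [|k IH] kn.
  by rewrite subn0 expr0 mul1r.
have e : (n - k = (n - k.+1).+1)%N by rewrite subnSK.
have [wI wE] := Dhat_at_I w n Dw In (n - k) (leq_subr _ _).
have [wI' wE'] := Dhat_at_I w' n Dw' In' (n - k) (leq_subr _ _).
rewrite e in wI wE wI' wE'.
rewrite (Dhat_ft _ _ Dw wI wE) (Dhat_ft _ _ Dw' wI' wE').
apply: (le_trans (ft_lip _ _)).
by rewrite exprS -mulrA ler_pM2l// -e IH// ltnW.
Qed.

Lemma coord1_continuous j : continuous (fun w : Th => (w j).1).
Proof. by move=> w; apply: continuous_comp; [exact: thr_proj_continuous|exact: cvg_fst]. Qed.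

Lemma coord2_continuous j : continuous (fun w : Th => (w j).2).
Proof. by move=> w; apply: continuous_comp; [exact: thr_proj_continuous|exact: cvg_snd]. Qed.

Lemma coord1_cvg (U : set_system nat) (w : nat -> Th) (p : Th) j :
  w @ U --> p -> (fun n => (w n j).1) @ U --> (p j).1.
Proof.
move=> wp; apply: (@cvg_comp _ _ _ w (fun v : Th => (v j).1) U (nbhs p) (nbhs (p j).1) wp).
exact: coord1_continuous.
Qed.

Lemma coord2_cvg (U : set_system nat) (w : nat -> Th) (p : Th) j :
  w @ U --> p -> (fun n => (w n j).2) @ U --> (p j).2.
Proof.
move=> wp; apply: (@cvg_comp _ _ _ w (fun v : Th => (v j).2) U (nbhs p) (nbhs (p j).2) wp).
exact: coord2_continuous.
Qed.

(** A fixed coordinate [j] of [w n] lies in [I] once [n >= j], so every coordinate of the limit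
    does, and continuity of the tent map carries the thread relation over. This places the limit in
    [Dhat]. *)
Lemma Dhat_limit (U : set_system nat) (w : nat -> Th) (p : Th) :
  ProperFilter U -> \oo `<=` U -> w @ U --> p ->
  (forall n, Dhat H (w n)) -> (forall n, IinD (w n n)) ->
  forall j, [/\ -1 <= (p j).1 <= 1, p j = inI (p j).1 & (p j).1 = ft t (p j.+1).1].
Proof.
move=> PU sU wp Dw Iw j.
have c1 i : (fun n => (w n i).1) @ U --> (p i).1.
  exact: coord1_cvg wp.
have c2 i : (fun n => (w n i).2) @ U --> (p i).2.
  exact: coord2_cvg wp.
have wI i n : (i <= n)%N -> -1 <= (w n i).1 <= 1 /\ w n i = inI (w n i).1.
  exact: (Dhat_at_I (w n) n (Dw n) (Iw n)).
split.
- have := @lim_itv R U _ _ PU (c1 j); rewrite /= in_itv/=; apply.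
  apply: sU; exists j => // n /= jn; rewrite in_itv/=.
  by case: (wI j n jn).
- suff : (p j).2 = 0 by case: (p j) => x y /= ->.
  apply: (@lim_unique_of_diff R U _ (cst 0) _ _ PU sU (c2 j)); first exact: cvg_cst.
  apply: (@cvg0_of_le_harmonic _ _ j) => n jn.
  by have [_ ->] := wI j n jn; rewrite /= subrr normr0.
- have cf : (fun n => ft t (w n j.+1).1) @ U --> ft t (p j.+1).1.
    apply: (@cvg_comp _ _ _ _ (ft t) U (nbhs (p j.+1).1) (nbhs (ft t (p j.+1).1)) (c1 j.+1)).
    exact: ft_continuous.
  apply: (@lim_unique_of_diff R U _ _ _ _ PU sU (c1 j) cf).
  apply: (@cvg0_of_le_harmonic _ _ j.+1) => n jn.
  have [wI1 wE1] := wI j.+1 n jn.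
  by rewrite (Dhat_ft _ _ (Dw n) wI1 wE1) subrr normr0.
Qed.

Lemma Dhat_unif (a : Th -> R) (e : R) : {within Dhat H, continuous a} -> 0 < e ->
  exists n (dl : R), 0 < dl /\
    forall w w', Dhat H w -> Dhat H w' -> IinD (w n) -> IinD (w' n) ->
    `|(w n).1 - (w' n).1| <= dl -> `|a w - a w'| <= e.
Proof.
move=> ca e0; apply: contrapT => nuc.
(* The factor [2 ^+ n] outweighs the expansion in [Dhat_contract]: every coordinate [j <= n] differs
   by at most [1 / (n + 1)], so the two limits coincide. *)
have bad n : exists ww : Th * Th, [/\ Dhat H ww.1, Dhat H ww.2, IinD (ww.1 n), IinD (ww.2 n) &
   `|(ww.1 n).1 - (ww.2 n).1| <= (2 ^+ n * n.+1%:R)^-1 /\ e < `|a ww.1 - a ww.2|].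
  apply: contrapT => h; apply: nuc; exists n, (2 ^+ n * n.+1%:R)^-1; split.
    by rewrite invr_gt0 mulr_gt0// exprn_gt0.
  move=> w w' Dw Dw' In In' ww'; rewrite leNgt; apply/negP => eww.
  by apply: h; exists (w, w').
have [ww wwP] := choice bad.
pose w n := (ww n).1; pose w' n := (ww n).2.
have Dw n : Dhat H (w n) by case: (wwP n).
have Dw' n : Dhat H (w' n) by case: (wwP n).
have Iw n : IinD (w n n) by case: (wwP n).
have Iw' n : IinD (w' n n) by case: (wwP n).
have [|||n] := @close_values Th R thread_box (Dhat H) a w w' e
  thread_box_compact ca e0 _ _ Dw Dw'.
- by move=> n j; apply: Dset_box; case: (Dw n j).
- by move=> n j; apply: Dset_box; case: (Dw' n j).
- move=> U p p' UU sU wp wp'.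
  have lp := Dhat_limit U w p (@ultra_proper _ _ UU) sU wp Dw Iw.
  have lp' := Dhat_limit U w' p' (@ultra_proper _ _ UU) sU wp' Dw' Iw'.
  split.
    apply/funext => j; have [_ -> _] := lp j; have [_ -> _] := lp' j; congr inI.
    apply: (@lim_unique_of_diff R U _ _ _ _ _ sU (coord1_cvg _ _ _ _ wp)
      (coord1_cvg _ _ _ _ wp')).
    apply: (@cvg0_of_le_harmonic _ _ j) => n jn.
    apply: (le_trans (Dhat_contract _ _ _ (Dw n) (Dw' n) (Iw n) (Iw' n) _ jn)).
    have [_ _ _ _ [wn _]] := wwP n.
    apply: (@le_trans _ _ (2 ^+ n * (2 ^+ n * n.+1%:R)^-1)).
      apply: ler_pM => //.
      by rewrite ler_weXn2l ?leq_subr// ler1n.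
    by rewrite invfM mulrA divff ?mul1r// expf_neq0.
  move=> j; have [pI pE pf] := lp j; have [pI1 pE1 _] := lp j.+1.
  split; first by rewrite pE; exact: inI_Dset.
  by rewrite pE1 /H (Ht_inI fb t ufb Jt)// -pf -pE.
by have [_ _ _ _ [_]] := wwP n; rewrite /w /w'; lra.
Qed.

Lemma iter_Hhat (z : Th) k j : (j <= k)%N -> iter k (@Hhat R H) z j = iter (k - j) H (z 0%N).
Proof.
elim: k j => [|k IH] [|j] //= jk; first by rewrite IH// subn0.
by rewrite subSS IH.
Qed.

Lemma iter_Hhat_Dhat (z : Th) : Dhat H z -> (forall m, Dset (iter m H (z 0%N))) ->
  forall k, Dhat H (iter k (@Hhat R H) z).
Proof.
move=> Dz Dm; elim=> [//|k IH] [|n] /=; last exact: IH.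
by split => //; rewrite iter_Hhat// subn0; exact: (Dm k.+1).
Qed.

(* Above the annulus s <= 3/4 the map H only doubles s. *)
Definition thread (c : R * R) : Th := fun n => phi (c.1, c.2 / 2 ^+ n).

Lemma thread_Dhat c : Cbox c -> c.2 <= 3 / 4 -> Dhat H (thread c).
Proof.
move=> [c1 /andP[c20 c21]] c34 n.
have b k : Cbox (c.1, c.2 / 2 ^+ k) /\ c.2 / 2 ^+ k <= 3 / 4.
  have le : c.2 / 2 ^+ k <= c.2 by rewrite ler_piMr// invf_le1 ?exprn_gt0// exprn_ege1// ler1n.
  split; last exact: le_trans le c34.
  split => //=; rewrite divr_ge0 ?exprn_ge0//=; exact: le_trans le c21.
have [bn1 bn34] := b n.+1; have [bn bn34'] := b n.
split; first by exists (c.1, c.2 / 2 ^+ n).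
rewrite /thread /H (Ht_phi fb t fbid Jt)//= exprS invfM mulrCA mulVKf// min_l//.
by rewrite (le_trans bn34')//; lra.
Qed.

Lemma thread_regular c : Cbox c -> 1 / 2 <= c.2 <= 3 / 4 -> generic t mu (cos c.1) ->
  regular_hat H nu (thread c).
Proof.
move=> bc /andP[s1 s2] Gc.
have Dz := thread_Dhat c bc s2.
split=> // a ca.
have /andP[t1 t2] := Jset_itv t Jt.
case: (hnu) => nu1 _ nuH nup.
have x1 : -1 <= cos c.1 <= 1 by rewrite cos_geN1 cos_le1.
have v1 n : -1 <= iter n (ft t) (cos c.1) <= 1 by exact: iter_ft_itv.
have z0 : thread c 0 = phi c by rewrite /thread expr0 divr1; case: (c).
have Hc : H (phi c) = inI (cos c.1).
  by rewrite /H (Ht_phi fb t fbid Jt)// min_r ?phi_top//; lra.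
have itz m : iter m.+1 H (phi c) = inI (iter m (ft t) (cos c.1)).
  by rewrite iterSr Hc /H (iter_Ht_inI fb t ufb Jt).
have Dit k : Dhat H (iter k (@Hhat R H) (thread c)).
  apply: iter_Hhat_Dhat => // -[|m]; rewrite z0; first by exists c.
  by rewrite itz; exact: inI_Dset.
have ma : measurable_fun (Ihat : set ThM) (a : ThM -> R).
  apply: thr_continuous_measurable; first exact: Ihat_measurable.
  exact: continuous_subspaceW Ihat_Dhat ca.
have mp n : measurable_fun setT (fun w : ThM => (w n).1 : R).
  apply: thr_continuous_measurable => //; apply: continuous_subspaceT.
  exact: coord1_continuous.
have shad (e : R) : 0 < e ->
    shadows mu (fun i => iter i (ft t) (cos c.1)) nu Ihat
      (fun i => a (iter i (@Hhat R H) (thread c))) a e.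
  move=> e0; have [n [dl [dl0 uc]]] := Dhat_unif a e ca e0.
  have In w : Ihat w -> IinD (w n).
    by move=> /(Ihat_itv w n)[wI wE]; exists (w n).1; rewrite // /Iset /= in_itv.
  (* One step brings the base point into [I], and [n] more shift it to coordinate [n]. *)
  have E i : iter (i + n.+1) (@Hhat R H) (thread c) n = inI (iter i (ft t) (cos c.1)).
    rewrite iter_Hhat; last by rewrite addnS ltnW// ltnS leq_addl.
    by rewrite addnS subSn ?leq_addl// addnK z0 itz.
  have Ei i : IinD (iter (i + n.+1) (@Hhat R H) (thread c) n).
    by rewrite E; exists (iter i (ft t) (cos c.1)); rewrite // /Iset /= in_itv/=.
  exists n.+1, (fun w => (w n).1), dl; split => //; split.
  - move=> m j; rewrite -[X in measurable X]setTI; apply: mp => //; exact: cell_measurable.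
  - move=> m j.
    pose A : set (measurableTypeR R * measurableTypeR R) := cell m j `*` setT.
    have mA : measurable A by apply: measurableX => //; exact: cell_measurable.
    have := nup n A mA.
    have -> : [set z : ThM | A (z n)] = (fun w : ThM => (w n).1) @^-1` cell m j.
      by apply/seteqP; split => w; rewrite /A /=; [case|].
    have -> // : @inI R @^-1` A = cell m j.
    by apply/seteqP; split => w; rewrite /A /=; [case|].
  - by move=> y Iy; case: (Ihat_itv y n Iy).
  - by move=> y y' Iy Iy'; apply: uc; [exact: Ihat_Dhat|exact: Ihat_Dhat|exact: In|exact: In].
  split.
    move=> i y Iy h; apply: uc; [exact: Dit|exact: Ihat_Dhat|exact: Ei|exact: In|].
    by rewrite E.
  by move=> i i' h; apply: uc; [exact: Dit|exact: Dit|exact: Ei|exact: Ei|rewrite !E].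
have mu1 : mu setT = 1%E by case: acip.
have := equidistributed mu mu1 _ v1 Gc nu nu1 _ Ihat_measurable Ihat_full _ ma _ shad.
have := equidistributed_integrable mu _ v1 nu nu1 _ Ihat_measurable Ihat_full _ ma _ shad.
move=> ia; apply: birkhoff_cvg.
(* Regularity asks for the integral over [Dhat], while equidistribution was applied on [Ihat]. *)
rewrite (integral_full nu Ihat _ Ihat_measurable Ihat_full Ihat_Dhat).
by rewrite /Rintegral fineK//; apply: integrable_fin_num ia; exact: Ihat_measurable.
Qed.

End RegularHat.

Theorem mainTheorem5 (R : realType) (fb : R -> R * R -> R * R) :
  unwrapping fb ->
  (forall t, Jset t -> forall c, Cbox c -> c.2 <= 3 / 4 -> fb t (phi c) = phi c) ->
  forall t, Jset t ->
  forall mu : {measure set (measurableTypeR R) -> \bar R},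
    acip_on_I (ft t) mu ->
    (exists B : set (R * R),
        (forall z, B z -> regular_D (Ht fb t) mu z) /\ positive_dyds B) /\
    (forall nu : {measure set (ThrM R) -> \bar R},
        hat_measure (Ht fb t) mu nu ->
        exists Bh : set (Thr R),
          (forall z, Bh z -> regular_hat (Ht fb t) nu z) /\
          positive_dyds (@pi0 R @` Bh)).
Proof.
move=> ufb fbid t Jt mu acip.
have /andP[t1 t2] := Jset_itv t Jt.
have [G [mG GI G0 Gg]] := generic_points t t1 t2 mu acip.
have pos := annulus_pos G mG GI G0.
split.
  exists (annulus G); split => // z; exact: annulus_regular.
move=> nu hnu.
pose C := [set c : R * R | Cbox c /\ G (cos c.1) /\ 1 / 2 <= c.2 <= 3 / 4].
exists (thread @` C); split.
  move=> _ [c [bc [Gc s]] <-].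
  by apply: (thread_regular fb t ufb fbid Jt mu acip nu hnu) => //; exact: Gg.
suff -> : @pi0 R @` (thread @` C) = annulus G by [].
rewrite image_comp; apply: eq_imagel => c _.
by rewrite /pi0 /thread /= expr0 divr1; case: c.
Qed.
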